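(* Every oriented virtual link can be represented by a virtual braid whose closure is isotopic to the original link. That is, for every oriented virtual link diagram $L$ there exist $n\ge 1$ and a virtual braid $b$ on $n$ strands such that the closure of $b$ is virtually isotopic to $L$ as an oriented virtual link diagram.
   Context: A virtual link diagram is a generic immersion of finitely many circles in the plane in which every double point is marked either as a classical crossing (with over/under information) or as a virtual crossing (drawn as a crossing with a small circle around it, with no over/under information). It is oriented if each component is oriented. Virtual isotopy (also called virtual equivalence, or isotopy) is the equivalence relation on virtual link diagrams generated by the augmented Reidemeister moves: (A) planar isotopy and the classical Reidemeister moves I, II, III on classical crossings; (B) the moves of the same shape as Reidemeister I, II, III in which all crossings are virtual; (C) the special detour move, in which an arc containing two consecutive virtual crossings is moved across a classical crossing (a triangle move of Reidemeister III type with two virtual crossings and one classical crossing, where the moving arc is the one carrying both virtual crossings). Equivalently, virtual isotopy is generated by the classical Reidemeister moves and the detour move: an arc containing only a consecutive sequence of virtual crossings may be excised and redrawn transversally elsewhere, with all newly created crossings being virtual. The triangle moves with two classical crossings and one virtual crossing are not allowed. For oriented diagrams, the moves respect orientations. A virtual link is an equivalence class of diagrams under virtual isotopy. A virtual braid on $n$ strands is a braid diagram on $n$ strands in the classical sense (all strands monotone downwards from $n$ top endpoints to $n$ bottom endpoints) whose crossings may be classical or virtual. Its closure is the oriented virtual link diagram obtained by joining corresponding top and bottom endpoints by simple (crossing-free, unlinked) arcs as for classical braids, with the strands oriented downwards. *)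

(* Defs.v *)
From mathcomp Require Import all_boot all_order all_algebra all_fingroup.
From mathcomp Require Import reals.
From Stdlib Require Import Relations.
Set Implicit Arguments.
Unset Strict Implicit.
Unset Printing Implicit Defensive.
Import Order.TTheory GRing.Theory Num.Theory.
Local Open Scope ring_scope.

(* Diagrams are taken in the piecewise linear category: the immersed circles
   are closed polygons, planar isotopy and the Reidemeister moves are
   triangle moves (Reidemeister's Delta-moves). *)

Notation point R := (R * R)%type.
Notation edge R := ((R * R) * (R * R))%type.

Definition lerp (R : realType) (e : edge R) (t : R) : point R :=
  ((1 - t) * e.1.1 + t * e.2.1, (1 - t) * e.1.2 + t * e.2.2).

Definition seg (R : realType) (e : edge R) (p : point R) : Prop :=
  exists2 t : R, 0 <= t <= 1 & p = lerp e t.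

Definition inner (R : realType) (e : edge R) (p : point R) : Prop :=
  exists2 t : R, 0 < t < 1 & p = lerp e t.

Definition cross (R : realType) (e f : edge R) : Prop :=
  exists p : point R, inner e p /\ inner f p.

Definition edet (R : realType) (e f : edge R) : R :=
  (e.2.1 - e.1.1) * (f.2.2 - f.1.2) - (e.2.2 - e.1.2) * (f.2.1 - f.1.1).

(* The closed triangle abc; it may be degenerate. *)
Definition tri (R : realType) (a b c p : point R) : Prop :=
  exists s t u : R, [/\ 0 <= s, 0 <= t, 0 <= u, s + t + u = 1 &
    p = (s * a.1 + t * b.1 + u * c.1, s * a.2 + t * b.2 + u * c.2)].

(* The edges of the polygonal path with vertices p :: s. *)
Definition chain (R : realType) (p : point R) (s : seq (point R)) :
  seq (edge R) := zip (p :: s) s.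

Variant passing := Over | Under | Virtual.

Definition flip (m : passing) : passing :=
  match m with Over => Under | Under => Over | Virtual => Virtual end.

(* An oriented polygonal diagram is its list of directed edges, whose order is
   irrelevant, with a marking of the double points: [mark e f] tells how [e]
   passes [f], and is meaningful only when [e] and [f] are distinct edges that
   cross each other. *)
Record diagram (R : realType) := Diagram {
  edges : seq (edge R);
  mark : edge R -> edge R -> passing }.

(* General position, for polygonal curves with or without endpoints: two edges
   meet only at a common vertex through which the curve runs, or at a
   transversal crossing interior to both. Backtracking is thus excluded. *)
Record generic (R : realType) (E : seq (edge R))
    (m : edge R -> edge R -> passing) : Prop := Generic {
  generic_src : uniq [seq e.1 | e <- E];
  generic_tgt : uniq [seq e.2 | e <- E];
  generic_proper : forall e, e \in E -> e.1 != e.2;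
  generic_meet : forall e f p, e \in E -> f \in E -> e != f ->
    seg e p -> seg f p ->
    [\/ e.2 = p /\ f.1 = p,
        f.2 = p /\ e.1 = p |
        [/\ inner e p, inner f p & edet e f != 0]];
  generic_double : forall e f g p, e \in E -> f \in E -> g \in E ->
    e != f -> e != g -> f != g -> seg e p -> seg f p -> ~ seg g p;
  generic_mark : forall e f, e \in E -> f \in E -> e != f ->
    cross e f -> m f e = flip (m e f) }.

(* With [generic], the third condition says that each vertex is the target of
   exactly one edge and the source of exactly one edge, that is, that the edges
   form disjoint directed cycles: the components. The empty diagram is excluded,
   as a closure of a braid on n >= 1 strands is never empty. *)
Definition is_diagram (R : realType) (D : diagram R) : Prop :=
  [/\ edges D != [::],
      generic (edges D) (mark D) &
      perm_eq [seq e.1 | e <- edges D] [seq e.2 | e <- edges D]].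

Definition same_marks (R : realType) (E : seq (edge R)) (D D' : diagram R) :
    Prop :=
  forall e f, e \in E -> f \in E -> e != f -> cross e f ->
    mark D e f = mark D' e f.

(* D' is obtained from D by replacing the edge ab by the path acb; E is the
   unchanged part. The moves below restrict the content of the triangle. *)
Record delta (R : realType) (a b c : point R) (E : seq (edge R))
    (D D' : diagram R) : Prop := Delta {
  delta_l : is_diagram D;
  delta_r : is_diagram D';
  delta_edges_l : perm_eq (edges D) ((a, b) :: E);
  delta_edges_r : perm_eq (edges D') [:: (a, c), (c, b) & E];
  delta_marks : same_marks E D D' }.

(* The edges adjacent to ab are allowed to touch the triangle at a and b. *)
Definition misses (R : realType) (a b c : point R) (f : edge R) : Prop :=
  forall p, tri a b c p -> seg f p -> p = a \/ p = b.

Definition ends_outside (R : realType) (a b c : point R) (f : edge R) : Prop :=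
  ~ tri a b c f.1 /\ ~ tri a b c f.2.

(* f runs through the triangle, entering or leaving by the side ab; in general
   position its other intersection with the boundary is a crossing with exactly
   one of ac and cb, which must carry the same marking. *)
Definition runs_through (R : realType) (a b c : point R) (D D' : diagram R)
    (f : edge R) : Prop :=
  [/\ ends_outside a b c f, cross (a, b) f,
      cross (a, c) f -> mark D' (a, c) f = mark D (a, b) f &
      cross (c, b) f -> mark D' (c, b) f = mark D (a, b) f].

(* Planar isotopy, subdivision included (c on the edge ab): the triangle meets
   the rest of the diagram in disjoint chords from ab to the other sides. *)
Definition planar_move (R : realType) (a b c : point R) (E : seq (edge R))
    (D D' : diagram R) : Prop :=
  (forall f, f \in E -> misses a b c f \/ runs_through a b c D D' f) /\
  (forall f g p, f \in E -> g \in E -> f != g -> seg f p -> seg g p ->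
     ~ tri a b c p).

(* The edge f preceding or following ab is crossed by the new path, which
   creates a kink. *)
Definition R1_move (R : realType) (a b c : point R) (E : seq (edge R))
    (D D' : diagram R) : Prop :=
  exists2 f, f \in E &
    (forall g, g \in E -> g != f -> misses a b c g) /\
    ([/\ f.2 = a, ~ tri a b c f.1, cross (c, b) f &
         mark D' (c, b) f <> Virtual] \/
     [/\ f.1 = b, ~ tri a b c f.2, cross (a, c) f &
         mark D' (a, c) f <> Virtual]).

Definition R2_move (R : realType) (a b c : point R) (E : seq (edge R))
    (D D' : diagram R) : Prop :=
  exists2 f, f \in E &
    (forall g, g \in E -> g != f -> misses a b c g) /\
    [/\ ends_outside a b c f, cross (a, c) f, cross (c, b) f,
        mark D' (a, c) f = mark D' (c, b) f & mark D' (a, c) f <> Virtual].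

(* The edge ab is moved across the crossing of f and g. The last condition says
   that one of the three strands lies above the other two, which excludes the
   cyclic configuration. *)
Definition R3_move (R : realType) (a b c : point R) (E : seq (edge R))
    (D D' : diagram R) : Prop :=
  exists f g,
    [/\ f \in E, g \in E, f != g &
        forall h, h \in E -> h != f -> h != g -> misses a b c h] /\
    [/\ runs_through a b c D D' f, runs_through a b c D D' g &
        exists p, [/\ tri a b c p, inner f p & inner g p]] /\
    [/\ mark D (a, b) f <> Virtual, mark D (a, b) g <> Virtual,
        mark D f g <> Virtual &
        [\/ mark D (a, b) f = Over /\ mark D (a, b) g = Over,
            mark D (a, b) f = Under /\ mark D f g = Over |
            mark D (a, b) g = Under /\ mark D f g = Under]].

Definition virtual_along (R : realType) (P : seq (edge R)) (D : diagram R) :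
    Prop :=
  forall e f, e \in P -> f \in edges D -> e != f -> cross e f ->
    mark D e f = Virtual.

(* An arc from p to q with only virtual crossings is excised and redrawn
   elsewhere with only virtual crossings. Taking single edges or triangles, this
   covers the all-virtual Reidemeister moves and the triangle move in which the
   moving strand carries the two virtual crossings. *)
Definition detour_move (R : realType) (D D' : diagram R) : Prop :=
  exists (p q : point R) (s s' : seq (point R)) (E : seq (edge R)),
    [/\ p != q, last p s = q & last p s' = q] /\
    [/\ is_diagram D, is_diagram D',
        perm_eq (edges D) (chain p s ++ E) &
        perm_eq (edges D') (chain p s' ++ E)] /\
    [/\ same_marks E D D', virtual_along (chain p s) D &
        virtual_along (chain p s') D'].

Variant virtual_move (R : realType) (D D' : diagram R) : Prop :=
| Move_same of is_diagram D & is_diagram D' & perm_eq (edges D) (edges D') &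
    same_marks (edges D) D D'
| Move_planar a b c E of delta a b c E D D' & planar_move a b c E D D'
| Move_R1 a b c E of delta a b c E D D' & R1_move a b c E D D'
| Move_R2 a b c E of delta a b c E D D' & R2_move a b c E D D'
| Move_R3 a b c E of delta a b c E D D' & R3_move a b c E D D'
| Move_detour of detour_move D D'.

(* Moves relate valid diagrams only, so a diagram isotopic to a valid one is
   valid. *)
Definition virtually_isotopic (R : realType) : relation (diagram R) :=
  clos_refl_sym_trans (diagram R) (@virtual_move R).

(* Strand i starts at (bx i, btop), goes through the points of [bmid i] and
   ends at (bx (bperm i), bbot). The abscissa [bright] bounds the braid on the
   right. *)
Record braid_diagram (R : realType) (n : nat) := BraidDiagram {
  bx : 'I_n -> R;
  btop : R;
  bbot : R;
  bright : R;
  bperm : {perm 'I_n};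
  bmid : 'I_n -> seq (point R);
  bmark : edge R -> edge R -> passing }.

Definition strand (R : realType) (n : nat) (b : braid_diagram R n) (i : 'I_n) :
    seq (edge R) :=
  chain (bx b i, btop b) (rcons (bmid b i) (bx b (bperm b i), bbot b)).

Definition braid_edges (R : realType) (n : nat) (b : braid_diagram R n) :
    seq (edge R) :=
  flatten [seq strand b i | i <- enum 'I_n].

Record is_virtual_braid (R : realType) (n : nat) (b : braid_diagram R n) :
    Prop := IsVirtualBraid {
  braid_ends : forall i j : 'I_n, (i < j)%N -> bx b i < bx b j;
  braid_down : forall e, e \in braid_edges b -> e.2.2 < e.1.2;
  braid_left : forall e, e \in braid_edges b ->
    e.1.1 < bright b /\ e.2.1 < bright b;
  braid_generic : generic (braid_edges b) (bmark b) }.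

(* The closing arcs are nested rectangular arcs passing to the right of the
   braid, the last strand carrying the innermost one. *)
Definition closing_arc (R : realType) (n : nat) (b : braid_diagram R n)
    (i : 'I_n) : seq (edge R) :=
  let h : R := (n - i)%N%:R in
  chain (bx b i, bbot b)
    [:: (bx b i, bbot b - h); (bright b + h, bbot b - h);
        (bright b + h, btop b + h); (bx b i, btop b + h); (bx b i, btop b)].

Definition braid_closure (R : realType) (n : nat) (b : braid_diagram R n) :
    diagram R :=
  Diagram (braid_edges b ++ flatten [seq closing_arc b i | i <- enum 'I_n])
          (bmark b).

(* Main.v *)
Require Import Defs.
From mathcomp Require Import all_boot all_order all_algebra all_fingroup.
From mathcomp Require Import reals boolp.
From mathcomp Require Import ring lra zify.
From Stdlib Require Import Relations.

Set Implicit Arguments.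
Unset Strict Implicit.
Unset Printing Implicit Defensive.
Import Order.TTheory GRing.Theory Num.Theory.
Local Open Scope ring_scope.

(** An arc that meets the rest of a diagram in virtual crossings only may be
    excised and redrawn anywhere, again with virtual crossings only. Hence only
    the classical crossings stand in the way of a braid form, and it suffices to
    make the two edges of each of them go downwards, which is a local matter.

    Let [e] cross [f] classically, [e] not going downwards. A small triangle move
    near the crossing turns [e] into any direction that crosses [f] in the same
    sense ([turn]), and some downward direction does unless [f] is horizontal
    ([half_turn]). Two transversal edges are not both horizontal, so that, in a
    suitable order, both can be made to go downwards ([uncover]); no other
    crossing is affected, and finitely many moves put every classical crossing in
    this form ([descending]).

    Cutting off the tails of the downward edges ([separate]) splits the edges
    into a set [K] of downward edges, no two of them consecutive, which carries
    all the classical crossings, and the set [N] of the others, which have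
    virtual crossings only. Now each edge [pq] of [N] is redrawn by a detour: from
    [p] down to a point below the diagram, then around the diagram on the right
    along one of the nested arcs that close a braid, and then from a point above
    the diagram down to [q] ([invariant_step]). The two descending legs have one
    bend each, at a given height; general position only excludes finitely many
    abscissas for it ([route]).

    The result is the closure of a braid with one strand for each edge of [N]
    ([strandE], [routed_closure]). The [i]-th strand descends to the end of the
    [i]-th edge, follows the edge of [K] that starts there, if any, and then takes
    the descending leg of the edge of [N] that comes next. The legs and the edges
    of [K] all go downwards. *)

(** * Segments and general position *)

Lemma uniq_map_inj (T U : eqType) (h : T -> U) (s : seq T) x y :
  uniq (map h s) -> x \in s -> y \in s -> h x = h y -> x = y.
Proof.
elim: s => //= z s IH /andP[n u]; rewrite !inE.
move=> /orP[/eqP->|xs] /orP[/eqP->|ys] e //; last exact: IH.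
- by rewrite e map_f in n.
- by rewrite -e map_f in n.
Qed.

Section Geometry.
Variable R : realType.
Implicit Types (e f g : edge R) (p q a b c : point R) (E : seq (edge R)).
Implicit Types m : edge R -> edge R -> passing.

Lemma point_eq p q : p.1 = q.1 -> p.2 = q.2 -> p = q.
Proof. by case: p q => [? ?] [? ?] /= -> ->. Qed.

Lemma seg_src e : seg e e.1.
Proof. by exists 0; rewrite ?lexx ?ler01 //; apply: point_eq => /=; ring. Qed.

Lemma seg_tgt e : seg e e.2.
Proof. by exists 1; rewrite ?lexx ?ler01 //; apply: point_eq => /=; ring. Qed.

Lemma inner_seg e p : inner e p -> seg e p.
Proof. by case=> t /andP[t0 t1] ->; exists t; rewrite // !ltW. Qed.

Lemma seg_inner e p : seg e p -> p <> e.1 -> p <> e.2 -> inner e p.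
Proof.
case=> t /andP[t0 t1] -> n1 n2; exists t => //.
rewrite !lt_neqAle t0 t1 !andbT; apply/andP; split; apply/eqP => te.
  by apply: n1; rewrite -te; apply: point_eq => /=; ring.
by apply: n2; rewrite te; apply: point_eq => /=; ring.
Qed.

Lemma edge_coord e : e.1 <> e.2 -> e.2.1 - e.1.1 <> 0 \/ e.2.2 - e.1.2 <> 0.
Proof.
move=> n; case: (eqVneq (e.2.1 - e.1.1) 0) => [h1|/eqP]; last by left.
right=> h2; apply: n; apply: point_eq; lra.
Qed.

Lemma inner_ends e p : e.1 != e.2 -> inner e p -> p <> e.1 /\ p <> e.2.
Proof.
move=> /eqP/edge_coord n [t /andP[t0 t1] ->]; split=> h;
  have h1 := congr1 fst h; have h2 := congr1 snd h; move: h1 h2; rewrite /=;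
  move=> h1 h2; case: n => n; apply: n.
- suff: t * (e.2.1 - e.1.1) = 0 by move/eqP; rewrite mulf_eq0 gt_eqF //= => /eqP.
  lra.
- suff: t * (e.2.2 - e.1.2) = 0 by move/eqP; rewrite mulf_eq0 gt_eqF //= => /eqP.
  lra.
- suff: (1 - t) * (e.2.1 - e.1.1) = 0.
    by move/eqP; rewrite mulf_eq0 gt_eqF ?subr_gt0 //= => /eqP.
  lra.
- suff: (1 - t) * (e.2.2 - e.1.2) = 0.
    by move/eqP; rewrite mulf_eq0 gt_eqF ?subr_gt0 //= => /eqP.
  lra.
Qed.

Lemma edet_sym e f : edet f e = - edet e f.
Proof. by rewrite /edet; ring. Qed.

Definition meet_point e f : point R :=
  lerp e (((f.1.1 - e.1.1) * (f.2.2 - f.1.2)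
           - (f.1.2 - e.1.2) * (f.2.1 - f.1.1)) / edet e f).

Lemma meet_pointP e f p :
  edet e f != 0 -> seg e p -> seg f p -> p = meet_point e f.
Proof.
move=> d [t _ ->] [s _] h; rewrite /meet_point; congr lerp.
have h1 := congr1 fst h; have h2 := congr1 snd h; move: h1 h2 => /= h1 h2.
apply: (mulIf d); rewrite mulfVK // /edet.
have -> : f.1.1 - e.1.1 = t * (e.2.1 - e.1.1) - s * (f.2.1 - f.1.1) by lra.
have -> : f.1.2 - e.1.2 = t * (e.2.2 - e.1.2) - s * (f.2.2 - f.1.2) by lra.
ring.
Qed.

Lemma meet_unique e f p q : edet e f != 0 ->
  seg e p -> seg f p -> seg e q -> seg f q -> p = q.
Proof.
by move=> d ep fp eq fq; rewrite (meet_pointP d ep fp) (meet_pointP d eq fq).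
Qed.

(** General position alone, since the condition on the marks is trivial here. *)
Definition good E := generic E (fun _ _ => Virtual).

Lemma generic_good E m : generic E m -> good E.
Proof. by case=> *; split. Qed.

Lemma good_generic E m : good E ->
  (forall e f, e \in E -> f \in E -> e != f -> cross e f -> m f e = flip (m e f)) ->
  generic E m.
Proof. by case=> *; split. Qed.

Lemma good_perm E E' : perm_eq E E' -> good E -> good E'.
Proof.
move=> h; have mE := perm_mem h.
case=> h1 h2 h3 h4 h5 h6; split; rewrite -?(perm_uniq (perm_map _ h)) //.
- by move=> e; rewrite -mE; apply: h3.
- by move=> e f p; rewrite -!mE; apply: h4.
- by move=> e f g p; rewrite -!mE; apply: h5.
Qed.

Lemma good_catl E E' : good (E ++ E') -> good E.
Proof.
case=> h1 h2 h3 h4 h5 h6; move: h1 h2; rewrite !map_cat !cat_uniq.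
move=> /and3P[h1 _ _] /and3P[h2 _ _].
have s e : e \in E -> e \in E ++ E' by rewrite mem_cat => ->.
split=> //.
- by move=> e /s; apply: h3.
- by move=> e f p /s ? /s ?; apply: h4.
- by move=> e f g p /s ? /s ? /s ?; apply: h5.
Qed.

Lemma good_catr E E' : good (E ++ E') -> good E'.
Proof. by move/(good_perm (permEl (perm_catC _ _)))/good_catl. Qed.

Lemma good_tail e E : good (e :: E) -> good E.
Proof. by rewrite -cat1s; apply: good_catr. Qed.

Section Access.
Variables (E : seq (edge R)) (gE : good E).

Lemma good_uniq : uniq E.
Proof. exact: map_uniq (generic_src gE). Qed.

Lemma good_src e f : e \in E -> f \in E -> e.1 = f.1 -> e = f.
Proof. exact: uniq_map_inj (generic_src gE). Qed.

Lemma good_tgt e f : e \in E -> f \in E -> e.2 = f.2 -> e = f.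
Proof. exact: uniq_map_inj (generic_tgt gE). Qed.

Lemma good_neq e : e \in E -> e.1 != e.2.
Proof. exact: (generic_proper gE). Qed.

Lemma good_at_src e f : e \in E -> f \in E -> e != f -> seg f e.1 -> f.2 = e.1.
Proof.
move=> eE fE n s; case: (generic_meet gE eE fE n (seg_src e) s).
- by case=> h; move: (good_neq eE); rewrite h eqxx.
- by case.
- by case=> /(inner_ends (good_neq eE))[].
Qed.

Lemma good_at_tgt e f : e \in E -> f \in E -> e != f -> seg f e.2 -> f.1 = e.2.
Proof.
move=> eE fE n s; case: (generic_meet gE eE fE n (seg_tgt e) s).
- by case.
- by case=> _ h; move: (good_neq eE); rewrite h eqxx.
- by case=> /(inner_ends (good_neq eE))[].
Qed.

Lemma good_cross e f : e \in E -> f \in E -> e != f -> cross e f -> edet e f != 0.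
Proof.
move=> eE fE n [p [ip jp]].
case: (generic_meet gE eE fE n (inner_seg ip) (inner_seg jp)) => [[h _]|[h _]|[] //].
  by case: (inner_ends (good_neq eE) ip); rewrite h.
by case: (inner_ends (good_neq fE) jp); rewrite h.
Qed.

End Access.

(** The ways in which a further edge may be added to a set in general
    position: it may only share its ends with the edges that precede and
    follow it, and must cross the others away from their double points. *)
Lemma good_add e E : good E -> e.1 != e.2 ->
  (forall f p, f \in E -> seg e p -> seg f p ->
     [\/ p = e.1 /\ f.2 = e.1, p = e.2 /\ f.1 = e.2 |
         [/\ inner e p, inner f p, edet e f != 0 &
             forall g, g \in E -> g != f -> ~ seg g p]]) ->
  good (e :: E).
Proof.
move=> gE n H.
have ne f : f \in E -> f.1 != f.2 by apply: (good_neq gE).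
have dbl f g p : f \in E -> g \in E -> f != g -> seg e p -> seg f p -> ~ seg g p.
  move=> fE gE' fg ep fp gp.
  case: (H f p fE ep fp) => [[pe fe]|[pe fe]|[i _ _ h]].
  - case: (H g p gE' ep gp) => [[_ ge]|[p2 _]|[i _ _ _]].
    + by move/eqP: fg; apply; apply: (good_tgt gE) => //; rewrite fe ge.
    + by move: n; rewrite -pe -p2 eqxx.
    + by case: (inner_ends n i).
  - case: (H g p gE' ep gp) => [[p1 _]|[_ ge]|[i _ _ _]].
    + by move: n; rewrite -pe -p1 eqxx.
    + by move/eqP: fg; apply; apply: (good_src gE) => //; rewrite fe ge.
    + by case: (inner_ends n i).
  - by apply: (h g) => //; rewrite eq_sym.
have meet f p : f \in E -> seg e p -> seg f p ->
    [\/ e.2 = p /\ f.1 = p, f.2 = p /\ e.1 = p |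
        [/\ inner e p, inner f p & edet e f != 0]].
  move=> fE ep fp; case: (H f p fE ep fp) => [[-> ->]|[-> ->]|[? ? ? _]].
  - by apply: Or32.
  - by apply: Or31.
  - by apply: Or33.
split=> //=.
- rewrite (generic_src gE) andbT; apply/mapP => -[f fE h].
  have sf : seg f e.1 by rewrite h; apply: seg_src.
  case: (meet f e.1 fE (seg_src e) sf) => [[h1 _]|[h1 _]|[i _ _]].
  + by move: n; rewrite h1 eqxx.
  + by move: (ne f fE); rewrite -h h1 eqxx.
  + by case: (inner_ends n i).
- rewrite (generic_tgt gE) andbT; apply/mapP => -[f fE h].
  have sf : seg f e.2 by rewrite h; apply: seg_tgt.
  case: (meet f e.2 fE (seg_tgt e) sf) => [[_ h1]|[_ h1]|[i _ _]].
  + by move: (ne f fE); rewrite -h h1 eqxx.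
  + by move: n; rewrite h1 eqxx.
  + by case: (inner_ends n i).
- by move=> f; rewrite inE => /orP[/eqP->|/ne].
- move=> f g p; rewrite !inE => /orP[/eqP->|fE] /orP[/eqP->|gE'].
  + by rewrite eqxx.
  + by move=> _; apply: meet.
  + move=> _ fp ep; case: (meet f p fE ep fp) => [h|h|[? ? d]].
    * exact: Or32.
    * exact: Or31.
    * by apply: Or33; split=> //; rewrite edet_sym oppr_eq0.
  + exact: (generic_meet gE).
- move=> f g h p; rewrite !inE => /orP[/eqP->|fE] /orP[/eqP->|gE'] /orP[/eqP->|hE];
    rewrite ?eqxx // => n1 n2 n3 s1 s2 s3.
  + exact: (dbl g h p).
  + exact: (dbl f h p).
  + exact: (dbl f g p).
  + exact: (generic_double gE fE gE' hE n1 n2 n3 s1 s2 s3).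
Qed.

(** Transversal edges meet once, so that a finite set of edges in general
    position has finitely many double points. *)
Lemma double_points E : good E -> exists W : seq (point R),
  (forall e, e \in E -> e.1 \in W /\ e.2 \in W) /\
  (forall e f p, e \in E -> f \in E -> e != f -> seg e p -> seg f p -> p \in W).
Proof.
move=> gE.
pose V := [seq e.1 | e <- E] ++ [seq e.2 | e <- E].
exists (V ++ [seq meet_point e f | e <- E, f <- E]).
have hV e : e \in E -> e.1 \in V /\ e.2 \in V.
  by move=> eE; rewrite !mem_cat !map_f // orbT.
split=> [e /hV[]|e f p eE fE n ep fp]; first by rewrite !mem_cat => -> ->.
rewrite mem_cat; case: (generic_meet gE eE fE n ep fp) => [[<- _]|[<- _]|[_ _ d]].
- by case: (hV e eE) => _ ->.
- by case: (hV f fE) => _ ->.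
- by apply/orP; right; rewrite (meet_pointP d ep fp); apply: allpairs_f.
Qed.

Lemma avoid (l : seq R) (lo hi : R) : lo < hi ->
  exists2 x, lo < x < hi & x \notin l.
Proof.
elim: l lo hi => [|a l IH] lo hi h; first by exists ((lo + hi) / 2); rewrite ?midf_lt.
have [a1 a2] : lo < (lo + hi) / 2 /\ (lo + hi) / 2 < hi by rewrite !midf_lt.
case: (ltP a ((lo + hi) / 2)) => ha.
- case: (IH _ _ a2) => x /andP[x1 x2] xl; exists x; first by rewrite x2 (lt_trans a1).
  by rewrite inE negb_or xl andbT gt_eqF // (lt_trans ha).
- case: (IH _ _ a1) => x /andP[x1 x2] xl; exists x; first by rewrite x1 (lt_trans x2).
  by rewrite inE negb_or xl andbT lt_eqF // (lt_le_trans x2).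
Qed.

(** Coordinates with origin [p] and axes [u] and [v]. *)
Definition frame p u v (x y : R) : point R :=
  (p.1 + x * u.1 + y * v.1, p.2 + x * u.2 + y * v.2).

(** A point off a segment is strictly separated from it by a line, hence has a
    neighbourhood that avoids it; it is measured in coordinates adapted to the
    crossing that is to be turned. *)
Lemma clearance1 (p u v : point R) e : e.1 != e.2 -> ~ seg e p ->
  exists2 d, 0 < d & forall x y : R, `|x| <= d -> `|y| <= d ->
    ~ seg e (frame p u v x y).
Proof.
move=> ne ns.
(* An affine form that is positive at [p] and not on [e] stays positive near [p]. *)
have sep (al be ga : R) : 0 < al * p.1 + be * p.2 + ga ->
    (forall t : R, 0 <= t <= 1 -> al * (lerp e t).1 + be * (lerp e t).2 + ga <= 0) ->
    exists2 d, 0 < d & forall x y : R, `|x| <= d -> `|y| <= d ->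
    ~ seg e (frame p u v x y).
  set l := _ + ga => l0 hl.
  set A := al * u.1 + be * u.2; set B := al * v.1 + be * v.2.
  have M0 : 0 < `|A| + `|B| + 1 by apply: ltr_pwDr => //; apply: addr_ge0.
  exists (l / (`|A| + `|B| + 1)); first exact: divr_gt0.
  set d := _ / _ => x y hx hy [t ht hp].
  have d0 : 0 < d by apply: divr_gt0.
  have dl : d * (`|A| + `|B| + 1) = l by rewrite mulfVK // gt_eqF.
  have := hl t ht; rewrite -hp /=.
  have hA : - (d * `|A|) <= x * A.
    have : `|x * A| <= d * `|A| by rewrite normrM ler_wpM2r.
    by rewrite ler_norml => /andP[].
  have hB : - (d * `|B|) <= y * B.
    have : `|y * B| <= d * `|B| by rewrite normrM ler_wpM2r.
    by rewrite ler_norml => /andP[].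
  have : 0 < l + x * A + y * B.
    move: dl hA hB d0; rewrite !mulrDr mulr1; clear.
    clearbody l d A B; move: (d * `|A|) (d * `|B|) (x * A) (y * B) => *; lra.
  by rewrite /l /A /B => h1 h2; lra.
set dx := e.2.1 - e.1.1; set dy := e.2.2 - e.1.2.
set D := dx * (p.2 - e.1.2) - dy * (p.1 - e.1.1).
(* If [p] is off the line of [e], this line separates; otherwise a
   perpendicular at one end does. *)
have [Dp|Dn|D0] := ltgtP 0 D.
- apply: (sep (- dy) dx (dy * e.1.1 - dx * e.1.2)); first by rewrite /D in Dp; lra.
  move=> t _; rewrite le_eqVlt; apply/orP; left; apply/eqP.
  by rewrite /= /dx /dy; ring.
- apply: (sep dy (- dx) (- (dy * e.1.1 - dx * e.1.2))); first by rewrite /D in Dn; lra.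
  move=> t _; rewrite le_eqVlt; apply/orP; left; apply/eqP.
  by rewrite /= /dx /dy; ring.
have n0 : 0 < dx ^+ 2 + dy ^+ 2.
  rewrite lt_neqAle addr_ge0 ?sqr_ge0 // andbT eq_sym paddr_eq0 ?sqr_ge0 //.
  rewrite !sqrf_eq0; apply/negP => /andP[/eqP h1 /eqP h2]; move/eqP: ne; apply.
  by rewrite /dx /dy in h1 h2; apply: point_eq; lra.
set S := dx * (p.1 - e.1.1) + dy * (p.2 - e.1.2).
have lS t : dx * (lerp e t).1 + dy * (lerp e t).2 - (dx * e.1.1 + dy * e.1.2)
    = t * (dx ^+ 2 + dy ^+ 2) by rewrite /= /dx /dy; ring.
have [S0|Sn] := leP 0 S; last first.
  apply: (sep (- dx) (- dy) (dx * e.1.1 + dy * e.1.2)); first by rewrite /S in Sn; lra.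
  move=> t /andP[t0 t1]; have := lS t; have : 0 <= t * (dx ^+ 2 + dy ^+ 2).
    by rewrite mulr_ge0 // ltW.
  by lra.
have [S1|Sp] := leP S (dx ^+ 2 + dy ^+ 2); last first.
  apply: (sep dx dy (- (dx * e.1.1 + dy * e.1.2) - (dx ^+ 2 + dy ^+ 2))).
    by rewrite /S in Sp; lra.
  move=> t /andP[t0 t1]; have := lS t.
  have : t * (dx ^+ 2 + dy ^+ 2) <= 1 * (dx ^+ 2 + dy ^+ 2) by rewrite ler_wpM2r // ltW.
  by lra.
case: ns; exists (S / (dx ^+ 2 + dy ^+ 2)).
  by apply/andP; split; [apply: divr_ge0 => //; apply: ltW|rewrite ler_pdivrMr // mul1r].
have nz : dx ^+ 2 + dy ^+ 2 != 0 by rewrite gt_eqF.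
apply: point_eq; apply: (mulIf nz) => /=.
  have -> : ((1 - S / (dx ^+ 2 + dy ^+ 2)) * e.1.1 + S / (dx ^+ 2 + dy ^+ 2) * e.2.1)
      = e.1.1 + S / (dx ^+ 2 + dy ^+ 2) * dx by rewrite /dx; ring.
  rewrite mulrDl mulrAC mulfVK //.
  have -> : p.1 = e.1.1 + (p.1 - e.1.1) by ring.
  have h : dy * D = 0 by rewrite -D0 mulr0.
  by rewrite /S /D in h *; lra.
have -> : ((1 - S / (dx ^+ 2 + dy ^+ 2)) * e.1.2 + S / (dx ^+ 2 + dy ^+ 2) * e.2.2)
    = e.1.2 + S / (dx ^+ 2 + dy ^+ 2) * dy by rewrite /dy; ring.
rewrite mulrDl mulrAC mulfVK //.
have h : dx * D = 0 by rewrite -D0 mulr0.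
by rewrite /S /D in h *; lra.
Qed.

Lemma clearance (p u v : point R) E : (forall e, e \in E -> e.1 != e.2) ->
  exists2 d, 0 < d & forall e (x y : R), e \in E -> ~ seg e p ->
    `|x| <= d -> `|y| <= d ->
    ~ seg e (frame p u v x y).
Proof.
elim: E => [|e E IH] h; first by exists 1.
have [d d0 hd] := IH (fun f fE => h f (mem_behead (s := e :: E) fE)).
have [|ns] := pselect (seg e p).
  move=> s; exists d => // f x y; rewrite inE => /orP[/eqP->|]; last exact: hd.
  by [].
have [d' d'0 hd'] := clearance1 u v (h e (mem_head _ _)) ns.
exists (Num.min d d'); first by rewrite lt_min d0.
move=> f x y; rewrite inE !le_min => /orP[/eqP->|fE] nf /andP[? ?] /andP[? ?].
  exact: hd'.
exact: hd.
Qed.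

End Geometry.

(** * Planar moves and subdivision *)

Section Moves.
Variable R : realType.
Implicit Types (e f g : edge R) (p q a b c : point R) (E : seq (edge R)).
Implicit Types (D : diagram R) (P : seq (point R)).

Lemma diagram_good D : is_diagram D -> good (edges D).
Proof. by case=> _ /generic_good. Qed.

Lemma chain_src p (s : seq (point R)) :
  perm_eq (last p s :: [seq e.1 | e <- chain p s]) (p :: s).
Proof.
elim: s p => [|x s IH] p //=.
by apply/seq.permP => P; have /seq.permP/(_ P) := IH x; rewrite /= addnCA => ->.
Qed.

Lemma chain_tgt p (s : seq (point R)) : [seq e.2 | e <- chain p s] = s.
Proof. by elim: s p => [|x s IH] p //=; rewrite IH. Qed.

Definition old_edge a b c e := if (e == (a, c)) || (e == (c, b)) then (a, b) else e.

(** The new edges inherit the marks of the edge that they replace. *)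
Definition bent D a b c E :=
  Diagram [:: (a, c), (c, b) & E]
    (fun e f => mark D (old_edge a b c e) (old_edge a b c f)).

Lemma tri1 a b c p : seg (a, c) p -> tri a b c p.
Proof.
case=> t /andP[t0 t1] ->; exists (1 - t), 0, t; split=> //; first (by rewrite subr_ge0); first by ring.
by apply: point_eq => /=; ring.
Qed.

Lemma tri2 a b c p : seg (c, b) p -> tri a b c p.
Proof.
case=> t /andP[t0 t1] ->; exists 0, t, (1 - t); split=> //; first (by rewrite subr_ge0); first by ring.
by apply: point_eq => /=; ring.
Qed.

Section Bend.
Variables (D : diagram R) (a b c : point R) (E : seq (edge R)).
Hypothesis hD : is_diagram D.
Hypothesis hE : perm_eq (edges D) ((a, b) :: E).
Hypothesis hg : good [:: (a, c), (c, b) & E].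
Hypothesis hf : forall f, f \in E -> misses a b c f \/
  ends_outside a b c f /\ cross (a, b) f.
Hypothesis hff : forall f g p, f \in E -> g \in E -> f != g -> seg f p ->
  seg g p -> tri a b c p -> seg (a, b) p.

Let gD : good ((a, b) :: E).
Proof. exact: (good_perm hE (diagram_good hD)). Qed.

Lemma old_edge_id e : e \in E -> old_edge a b c e = e.
Proof.
move=> eE; case/and3P: (good_uniq hg); rewrite inE negb_or => /andP[_ n1] n2 _.
rewrite /old_edge; case: ifP => // /orP[]/eqP ee; first by rewrite -ee eE in n1.
by rewrite -ee eE in n2.
Qed.

Lemma old_edge1 : old_edge a b c (a, c) = (a, b).
Proof. by rewrite /old_edge eqxx. Qed.

Lemma old_edge2 : old_edge a b c (c, b) = (a, b).
Proof. by rewrite /old_edge eqxx orbT. Qed.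

Lemma old_edge_mem e : e \in edges (bent D a b c E) -> old_edge a b c e \in edges D.
Proof.
rewrite /= (perm_mem hE) !inE => /or3P[/eqP->|/eqP->|eE].
- by rewrite old_edge1 eqxx.
- by rewrite old_edge2 eqxx.
- by rewrite old_edge_id // eE orbT.
Qed.

Let abE e : e \in E -> (a, b) != e.
Proof. by move=> eE; apply/eqP => h; have := good_uniq gD; rewrite /= h eE. Qed.

Lemma new_cross e f : e \in [:: (a, c); (c, b)] -> f \in E -> cross e f ->
  cross (a, b) f.
Proof.
move=> eN fE ef; case: (hf fE) => [mf|[] //].
have fN : f \notin [:: (a, c); (c, b)].
  by have := good_uniq hg; rewrite (cat_uniq [:: _; _]) => /and3P[_ /hasPn/(_ _ fE) ?].
have [n1 n2] : (a, c) != f /\ (c, b) != f.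
  by move: fN; rewrite !inE negb_or ![f == _]eq_sym => /andP[].
have n3 : (a, c) != (c, b).
  by apply/eqP => h; have := good_uniq hg; rewrite h /= inE eqxx.
have [m1 m2 m3] : [/\ (a, c) \in [:: (a, c), (c, b) & E],
  (c, b) \in [:: (a, c), (c, b) & E] & f \in [:: (a, c), (c, b) & E]].
  by rewrite !inE !eqxx fE !orbT.
have e1 := good_neq hg m1; have e2 := good_neq hg m2.
case: ef => p []; move: eN; rewrite !inE => /orP[]/eqP-> ip jp.
- case: (mf p (tri1 b (inner_seg ip)) (inner_seg jp)) => pp.
    by case: (inner_ends e1 ip).
  case: (generic_double hg m1 m2 m3 n3 n1 n2 (inner_seg ip) _ (inner_seg jp)).
  by rewrite pp; apply: seg_tgt.
- case: (mf p (tri2 a (inner_seg ip)) (inner_seg jp)) => pp; last first.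
    by case: (inner_ends e2 ip).
  case: (generic_double hg m1 m2 m3 n3 n1 n2 _ (inner_seg ip) (inner_seg jp)).
  by rewrite pp; apply: (seg_src (a, c)).
Qed.

Lemma new_disjoint : ~ cross (a, c) (c, b).
Proof.
have n3 : (a, c) != (c, b).
  by apply/eqP => h; have := good_uniq hg; rewrite h /= inE eqxx.
have [m1 m2] : (a, c) \in [:: (a, c), (c, b) & E] /\
  (c, b) \in [:: (a, c), (c, b) & E] by rewrite !inE !eqxx !orbT.
move=> x; have d := good_cross hg m1 m2 n3 x; case: x => p [ip jp].
have := meet_unique d (inner_seg ip) (inner_seg jp) (seg_tgt (a, c)) (seg_src (c, b)).
by case: (inner_ends (good_neq hg m1) ip).
Qed.

Lemma cross_sym e f : cross e f -> cross f e.
Proof. by case=> p [? ?]; exists p. Qed.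

Lemma old_edge_cross e f :
  e \in edges (bent D a b c E) -> f \in edges (bent D a b c E) -> e != f ->
  cross e f ->
  old_edge a b c e != old_edge a b c f /\ cross (old_edge a b c e) (old_edge a b c f).
Proof.
have case2 g : g \in edges (bent D a b c E) ->
    g \in [:: (a, c); (c, b)] /\ old_edge a b c g = (a, b) \/ g \in E.
  rewrite /= !inE; case/or3P => [/eqP->|/eqP->|]; last by right.
  - by left; rewrite old_edge1 eqxx.
  - by left; rewrite old_edge2 eqxx orbT.
move=> /case2[[e1 e2]|eE] /case2[[f1 f2]|fE] n x.
- move: n x; move: e1 f1; rewrite !inE => /orP[]/eqP-> /orP[]/eqP->; rewrite ?eqxx //.
  + by move=> _ /new_disjoint.
  + by move=> _ /cross_sym/new_disjoint.
- by rewrite e2 old_edge_id //; split; [apply: abE | apply: new_cross x].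
- rewrite f2 old_edge_id //; split; first by rewrite eq_sym; apply: abE.
  by apply/cross_sym; apply: (@new_cross f) => //; apply/cross_sym.
- by rewrite !old_edge_id.
Qed.

(** General position of the result is all that has to be checked in order to
    push an edge across a triangle. *)
Lemma bend : is_diagram (bent D a b c E) /\ virtual_move D (bent D a b c E).
Proof.
have dD' : is_diagram (bent D a b c E).
  split=> //.
    apply: (good_generic hg) => e f eE fE n x; case: hD => _ gm _.
    have [n' x'] := old_edge_cross eE fE n x.
    exact: (generic_mark gm (old_edge_mem eE) (old_edge_mem fE) n' x').
  case: hD => _ _ /seq.permP h; apply/seq.permP => Q.
  have /seq.permP h1 := perm_map (fun e : edge R => e.1) hE.
  have /seq.permP h2 := perm_map (fun e : edge R => e.2) hE.
  by have := h Q; rewrite h1 h2 /= => h'; rewrite addnCA h'.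
split=> //; apply: (@Move_planar _ _ _ a b c E).
  split=> // e f eE fE n x.
  by rewrite /= !old_edge_id.
split=> [f fE|f g p fE gE n sf sg t].
  case: (hf fE) => [|[eo x]]; first by left.
  right; split=> // _; rewrite /= (old_edge_id fE) ?old_edge1 ?old_edge2 //.
have [m1 m2 m3] : [/\ (a, b) \in (a, b) :: E, f \in (a, b) :: E & g \in (a, b) :: E].
  by rewrite !inE eqxx fE gE !orbT.
exact: (generic_double gD m1 m2 m3 (abE fE) (abE gE) n (hff fE gE n sf sg t)).
Qed.

End Bend.

Definition down e := e.2.2 < e.1.2.

(** The crossings still to be turned are bounded by a list of points rather than
    counted, because such a list is unaffected by subdivision. *)
Definition covers D P := forall e f p, e \in edges D -> f \in edges D ->
  e != f -> inner e p -> inner f p -> mark D e f <> Virtual -> ~~ down e ->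
  p \in P.

Lemma lerp_inj e s t : e.1 <> e.2 -> lerp e s = lerp e t -> s = t.
Proof.
move=> /edge_coord n h; have h1 := congr1 fst h; have h2 := congr1 snd h.
move: h1 h2 => /= h1 h2; apply/eqP; rewrite -subr_eq0.
case: n => /eqP n; apply/eqP; apply: (mulIf n); rewrite mul0r; lra.
Qed.

Section Halves.
Variables a b c : point R.
Hypothesis hab : a != b.
Hypothesis hc : inner (a, b) c.

Lemma half1 p : seg (a, c) p -> seg (a, b) p.
Proof.
case: hc => t /andP[t0 t1] -> [s /andP[s0 s1] ->]; exists (s * t).
  have t0' := ltW t0; have t1' := ltW t1.
  by apply/andP; split; [apply: mulr_ge0|apply: mulr_ile1].
by apply: point_eq => /=; ring.
Qed.

Lemma half2 p : seg (c, b) p -> seg (a, b) p.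
Proof.
case: hc => t /andP[t0 t1] -> [s /andP[s0 s1] ->]; exists (t + s * (1 - t)).
  have : 0 <= s * (1 - t) <= 1 * (1 - t).
    have t1' : 0 <= 1 - t by rewrite subr_ge0 ltW.
    by apply/andP; split; [apply: mulr_ge0|apply: ler_wpM2r].
  by case/andP => h1 h2; apply/andP; split; lra.
by apply: point_eq => /=; ring.
Qed.

Lemma halves p : seg (a, c) p -> seg (c, b) p -> p = c.
Proof.
case: hc => t /andP[t0 t1] -> [s /andP[s0 s1] ->] [r /andP[r0 r1] h].
have h' : lerp (a, b) (s * t) = lerp (a, b) (t + r * (1 - t)).
  apply: etrans (etrans h _); apply: point_eq => /=; ring.
have {}h' := @lerp_inj (a, b) _ _ (elimN eqP hab) h'.
suff -> : s = 1 by apply: point_eq => /=; ring.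
have r' : 0 <= r * (1 - t) by apply: mulr_ge0; rewrite // subr_ge0 ltW.
have : (1 - s) * t <= 0 by lra.
rewrite pmulr_lle0 //; lra.
Qed.

Lemma half_down e : e \in [:: (a, c); (c, b)] -> down e = down (a, b).
Proof.
case: hc => t /andP[t0 t1] ->; rewrite /down !inE => /orP[]/eqP-> /=.
  have -> : (1 - t) * a.2 + t * b.2 = a.2 + t * (b.2 - a.2) by ring.
  by rewrite -subr_lt0 addrAC subrr add0r pmulr_rlt0 // subr_lt0.
have -> : (1 - t) * a.2 + t * b.2 = b.2 + (1 - t) * (a.2 - b.2) by ring.
by rewrite -subr_gt0 addrAC subrr add0r pmulr_rgt0 ?subr_gt0.
Qed.

Lemma half_edet e f : e \in [:: (a, c); (c, b)] -> edet (a, b) f != 0 -> edet e f != 0.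
Proof.
case: hc => t /andP[t0 t1] ->; rewrite !inE => /orP[]/eqP-> h.
- have -> : edet (a, lerp (a, b) t) f = t * edet (a, b) f by rewrite /edet /=; ring.
  by rewrite mulf_neq0 // gt_eqF.
- have -> : edet (lerp (a, b) t, b) f = (1 - t) * edet (a, b) f by rewrite /edet /=; ring.
  by rewrite mulf_neq0 // gt_eqF // subr_gt0.
Qed.

Lemma tri_flat p : tri a b c p -> seg (a, b) p.
Proof.
case: hc => t /andP[t0 t1] -> [r [s [u [r0 s0 u0 h ->]]]].
have t0' := ltW t0; have t1' := ltW t1.
have u1 : 0 <= u * t <= u * 1.
  by apply/andP; split; [apply: mulr_ge0|apply: ler_wpM2l].
exists (s + u * t); first by case/andP: u1 => ? ?; apply/andP; split; lra.
have -> : r = 1 - s - u by lra.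
by apply: point_eq => /=; ring.
Qed.

End Halves.

Section Subdivision.
Variables (D : diagram R) (a b c : point R) (E : seq (edge R)).
Hypothesis hD : is_diagram D.
Hypothesis hE : perm_eq (edges D) ((a, b) :: E).
Hypothesis hc : inner (a, b) c.
Hypothesis hcE : forall f, f \in E -> ~ seg f c.

Let gD : good ((a, b) :: E).
Proof. exact: (good_perm hE (diagram_good hD)). Qed.

Let abD : (a, b) \in (a, b) :: E.
Proof. exact: mem_head. Qed.

Let ED f : f \in E -> f \in (a, b) :: E.
Proof. by rewrite inE => ->; rewrite orbT. Qed.

Let abE e : e \in E -> (a, b) != e.
Proof. by move=> eE; apply/eqP => h; have := good_uniq gD; rewrite /= h eE. Qed.

Let hab : a != b.
Proof. exact: (good_neq gD abD). Qed.

Lemma subdivide_good : good [:: (a, c), (c, b) & E].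
Proof.
have [ca cb] := inner_ends (good_neq gD abD) hc.
have dbl f g p : f \in E -> g \in E -> g != f -> seg (a, b) p -> seg f p -> ~ seg g p.
  move=> fE gE n ab fp; rewrite eq_sym in n.
  exact: (generic_double gD abD (ED fE) (ED gE) (abE fE) (abE gE) n ab fp).
apply: good_add => [||f p]; last first.
- rewrite inE => /orP[/eqP->|fE] ep fp.
    by apply: Or32; rewrite /= (halves hab hc ep fp).
  case: (generic_meet gD abD (ED fE) (abE fE) (half1 hc ep) fp) => [[bp _]|[f2 ap]|[i j d]].
  + case: cb; rewrite bp; apply/esym; apply: (halves hab hc) => //.
    by rewrite -bp; apply: (seg_tgt (c, b)).
  + by apply: Or31; rewrite -ap in f2 *.
  + apply: Or33; split=> //.
    * apply: seg_inner => //=; first by move=> h; case: (inner_ends (good_neq gD abD) i).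
      by move=> h; case: (hcE fE); rewrite -h.
    * by apply: (half_edet hc); rewrite ?inE ?eqxx.
    * move=> g; rewrite inE => /orP[/eqP-> _ gp|gE n].
        by case: (hcE fE); rewrite -(halves hab hc ep gp).
      by apply: (dbl f g) => //; apply: (half1 hc).
- by apply/eqP => /esym.
apply: good_add => [||f p fE ep fp]; first exact: good_tail gD.
  by apply/eqP.
case: (generic_meet gD abD (ED fE) (abE fE) (half2 hc ep) fp) => [[bp f1]|[_ ap]|[i j d]].
- by apply: Or32; rewrite -bp in f1 *.
- case: ca; rewrite ap; apply/esym; apply: (halves hab hc) => //.
  by rewrite -ap; apply: (seg_src (a, c)).
- apply: Or33; split=> //.
  + apply: seg_inner => //=; last by move=> h; case: (inner_ends (good_neq gD abD) i).
    by move=> h; case: (hcE fE); rewrite -h.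
  + by apply: (half_edet hc); rewrite ?inE ?eqxx ?orbT.
  + by move=> g gE n; apply: (dbl f g) => //; apply: (half2 hc).
Qed.

Lemma subdivide_far f : f \in E ->
  misses a b c f \/ ends_outside a b c f /\ cross (a, b) f.
Proof.
move=> fE; case: (pselect (cross (a, b) f)) => x.
  right; split=> //; have d := good_cross gD abD (ED fE) (abE fE) x.
  case: x => q [iq jq]; have [q1 q2] := inner_ends (good_neq gD (ED fE)) jq.
  split=> /(tri_flat hc) h.
    by apply: q1; apply: (meet_unique d (inner_seg iq) (inner_seg jq) h (seg_src f)).
  by apply: q2; apply: (meet_unique d (inner_seg iq) (inner_seg jq) h (seg_tgt f)).
left=> p /(tri_flat hc) ep fp.
case: (generic_meet gD abD (ED fE) (abE fE) ep fp) => [[<- _]|[_ <-]|[i j _]]; try by [right|left].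
by case: x; exists p.
Qed.

(** Subdivision is the planar isotopy across a flat triangle. *)
Lemma subdivide :
  [/\ is_diagram (bent D a b c E), virtual_move D (bent D a b c E) &
      forall P, covers D P -> covers (bent D a b c E) P].
Proof.
have hff f g p (fE : f \in E) (gE : g \in E) (n : f != g) (sf : seg f p)
  (sg : seg g p) : tri a b c p -> seg (a, b) p := tri_flat hc (p := p).
have hf := subdivide_far; have hg := subdivide_good.
have [h1 h2] := bend hD hE hg hf hff.
split=> // P hP e f p eE fE n ei fi m dn.
have x : cross e f by exists p.
have [n' _] := old_edge_cross hD hE hg hf eE fE n x.
have inn g : g \in edges (bent D a b c E) -> inner g p -> inner (old_edge a b c g) p.
  have [m1 m2] : (a, c) \in [:: (a, c), (c, b) & E] /\
    (c, b) \in [:: (a, c), (c, b) & E] by rewrite !inE !eqxx !orbT.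
  have n1 := good_neq hg m1; have n2 := good_neq hg m2.
  rewrite /= !inE => /or3P[/eqP->|/eqP->|gE]; last by rewrite (old_edge_id hg).
  - rewrite old_edge1 => ip; have [p1 p2] := inner_ends n1 ip.
    apply: seg_inner => //; first exact: (half1 hc) (inner_seg ip).
    move=> pb; apply: p2; apply: (halves hab hc); first exact: inner_seg.
    by rewrite pb; apply: (seg_tgt (c, b)).
  - rewrite old_edge2 => ip; have [p1 p2] := inner_ends n2 ip.
    apply: seg_inner => //; first exact: (half2 hc) (inner_seg ip).
    move=> pa; apply: p1; apply: (halves hab hc); last exact: inner_seg.
    by rewrite pa; apply: (seg_src (a, c)).
apply: (hP (old_edge a b c e) (old_edge a b c f)) => //; try exact: (old_edge_mem hE hg).
- exact: inn.
- exact: inn.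
- move: eE dn; rewrite /= !inE => /or3P[/eqP->|/eqP->|gE]; last by rewrite (old_edge_id hg).
  + by rewrite old_edge1 (half_down hc) // inE eqxx.
  + by rewrite old_edge2 (half_down hc) // !inE eqxx orbT.
Qed.

End Subdivision.

End Moves.

(** * Turning the classical crossings downwards *)

Section Turn.
Variable R : realType.
Implicit Types (e f g : edge R) (p q a b c : point R) (E : seq (edge R)).
Implicit Types (D : diagram R) (P : seq (point R)).

Section Frame.
Variables (p u v : point R).
Hypothesis duv : u.1 * v.2 - u.2 * v.1 != 0.
Notation F := (frame p u v).

Lemma frame_inj x y x' y' : F x y = F x' y' -> x = x' /\ y = y'.
Proof.
move=> h; have h1 := congr1 fst h; have h2 := congr1 snd h; move: h1 h2 => /= h1 h2.
have e1 : (x - x') * u.1 + (y - y') * v.1 = 0 by lra.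
have e2 : (x - x') * u.2 + (y - y') * v.2 = 0 by lra.
split; apply/eqP; rewrite -subr_eq0; apply/eqP; apply: (mulIf duv); rewrite mul0r.
  have -> : (x - x') * (u.1 * v.2 - u.2 * v.1) =
    ((x - x') * u.1 + (y - y') * v.1) * v.2 - ((x - x') * u.2 + (y - y') * v.2) * v.1.
    by ring.
  by rewrite e1 e2; ring.
have -> : (y - y') * (u.1 * v.2 - u.2 * v.1) =
    ((x - x') * u.2 + (y - y') * v.2) * u.1 - ((x - x') * u.1 + (y - y') * v.1) * u.2.
  by ring.
by rewrite e1 e2; ring.
Qed.

Lemma frame_lerp x y x' y' t :
  lerp (F x y, F x' y') t = F ((1 - t) * x + t * x') ((1 - t) * y + t * y').
Proof. by apply: point_eq => /=; ring. Qed.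

Lemma frame_seg x y x' y' r : seg (F x y, F x' y') r ->
  exists2 t, 0 <= t <= 1 & r = F ((1 - t) * x + t * x') ((1 - t) * y + t * y').
Proof. by case=> t ht ->; exists t => //; apply: frame_lerp. Qed.

Lemma frame_tri x y x' y' x'' y'' r :
  tri (F x y) (F x' y') (F x'' y'') r ->
  exists s t w, [/\ 0 <= s, 0 <= t, 0 <= w, s + t + w = 1 &
    r = F (s * x + t * x' + w * x'') (s * y + t * y' + w * y'')].
Proof.
case=> s [t [w [s0 t0 w0 h ->]]]; exists s, t, w; split=> //.
have -> : s = 1 - t - w by lra.
by apply: point_eq => /=; ring.
Qed.

Lemma frame_edet x y x' y' z w z' w' :
  edet (F x y, F x' y') (F z w, F z' w') =
  (u.1 * v.2 - u.2 * v.1) * ((x' - x) * (w' - w) - (y' - y) * (z' - z)).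
Proof. by rewrite /edet /=; ring. Qed.

End Frame.

Section Triangle.
Variables (D : diagram R) (p u v : point R) (ep t k : R) (E : seq (edge R)).
Notation F := (frame p u v).
Notation a := (F (- ep) 0).
Notation b := (F ep 0).
Notation c := (F (- ep) (- (ep * t))).
Notation f := (F 0 (- k), F 0 (1 - k)).
Notation q := (F 0 (- (ep * t) / 2)).
Hypothesis duv : u.1 * v.2 - u.2 * v.1 != 0.
Hypothesis ep0 : 0 < ep.
Hypothesis t0 : t != 0.
Hypothesis k1 : - k < - (ep * t) < 1 - k.
Hypothesis k0 : 0 < k < 1.
Hypothesis hD : is_diagram D.
Hypothesis hE : perm_eq (edges D) ((a, b) :: E).
Hypothesis fE : f \in E.
Hypothesis hm : forall g, g \in E -> g != f -> misses a b c g.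

Ltac slra :=
  let h1 := fresh in let h2 := fresh in let h3 := fresh in
  pose proof ep0 as h1; pose proof k1 as h2; pose proof k0 as h3; lra.

Let gD : good ((a, b) :: E).
Proof. exact: (good_perm hE (diagram_good hD)). Qed.

Let abD : (a, b) \in (a, b) :: E.
Proof. exact: mem_head. Qed.

Let ED g : g \in E -> g \in (a, b) :: E.
Proof. by rewrite inE => ->; rewrite orbT. Qed.

Let abE g : g \in E -> (a, b) != g.
Proof. by move=> gE; apply/eqP => h; have := good_uniq gD; rewrite /= h gE. Qed.

Let ept : ep * t != 0.
Proof. by rewrite mulf_neq0 // gt_eqF. Qed.

Let inj x y x' y' : F x y = F x' y' -> x = x' /\ y = y'.
Proof. exact: frame_inj. Qed.

Let a_cb : ~ seg (c, b) a.
Proof.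
move=> /frame_seg[s hs /inj[h1 h2]].
have : (1 - s) * (ep * t) = 0 by slra.
move/eqP; rewrite mulf_eq0 (negPf ept) orbF => /eqP h3; have e1 : s = 1 by slra.
by rewrite e1 in h1; slra.
Qed.

Let b_ac : ~ seg (a, c) b.
Proof. by move=> /frame_seg[s hs /inj[h1 h2]]; slra. Qed.

Let at_q r : seg (c, b) r -> seg f r -> [/\ r = q, inner (c, b) r & inner f r].
Proof.
move=> /frame_seg[s hs ->] /frame_seg[s' hs' /inj[h1 h2]].
have {h1 hs} e1 : s = 1 / 2.
  have : (s - 1 / 2) * ep = 0 by slra.
  by move/eqP; rewrite mulf_eq0 (gt_eqF ep0) orbF => /eqP; slra.
have e2 : s' = k - ep * t / 2 by move: h2; rewrite e1; slra.
have e3 : F ((1 - s) * - ep + s * ep) ((1 - s) * - (ep * t) + s * 0) = q.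
  by rewrite e1; congr (F _ _); field.
split=> //.
- exists s; first by rewrite e1; slra.
  by rewrite frame_lerp.
- exists s'; last by rewrite frame_lerp h2; congr (F _ _); rewrite e1; field.
  by case/andP: k1 => ? ?; case/andP: k0 => ? ?; apply/andP; split; slra.
Qed.

Let f_ac r : seg (a, c) r -> ~ seg f r.
Proof. by move=> /frame_seg[s hs ->] /frame_seg[s' hs' /inj[h1 h2]]; slra. Qed.

Let ac_cb r : seg (a, c) r -> seg (c, b) r -> r = c.
Proof.
move=> /frame_seg[s hs ->] /frame_seg[s' hs' /inj[h1 h2]].
have : s' * ep = 0 by slra.
move/eqP; rewrite mulf_eq0 (gt_eqF ep0) orbF => /eqP z.
have : (1 - s) * (ep * t) = 0 by move: h2; rewrite z; slra.
move/eqP; rewrite mulf_eq0 (negPf ept) orbF => /eqP h3; have -> : s = 1 by slra.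
by congr (F _ _); ring.
Qed.

Let ncb : c != b.
Proof. by apply/eqP => /inj[h1 h2]; slra. Qed.

Let nac : a != c.
Proof. by apply/eqP => /inj[h1 h2]; move/eqP: ept; apply; slra. Qed.

Lemma turn_good : good [:: (a, c), (c, b) & E].
Proof.
apply: good_add => // [|g r]; last first.
- rewrite inE => /orP[/eqP->|gE] er gr; first by apply: Or32; rewrite /= (ac_cb er gr).
  case: (eqVneq g f) => [gf|gf]; first by case: (@f_ac r) => //; rewrite -gf.
  case: (hm gE gf (tri1 b er) gr) => ra; rewrite ra in er gr *.
  + by apply: Or31; split=> //; apply: (good_at_src gD abD (ED gE) (abE gE)).
  + by case: b_ac.
apply: good_add => // [|g r gE er gr]; first exact: good_tail gD.
case: (eqVneq g f) => [gf|gf].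
  rewrite gf in gr *; have [rq i1 i2] := at_q er gr; apply: Or33; split=> //.
    rewrite frame_edet mulf_neq0 //; apply/eqP; move/eqP: (ept); slra.
  move=> h hE' hf hr; case: (hm hE' hf (tri2 a er) hr) => ra; move: i1 (i1); rewrite {1}ra.
    by move/inner_seg/a_cb.
  by move=> _; case/(inner_ends (e := (c, b)) ncb) => _; rewrite ra.
case: (hm gE gf (tri2 a er) gr) => ra; rewrite ra in er gr *.
- by case: a_cb.
- by apply: Or32; split=> //; apply: (good_at_tgt gD abD (ED gE) (abE gE)).
Qed.

Lemma turn_far g : g \in E ->
  misses a b c g \/ ends_outside a b c g /\ cross (a, b) g.
Proof.
move=> gE; case: (eqVneq g f) => [->|gf]; last by left; apply: hm.
have w0 (w : R) : 0 <= w -> w <= 1 -> - k < - (w * (ep * t)) < 1 - k.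
  move=> w0 w1; have [/andP[h1 h2] /andP[h3 h4]] := (k1, k0).
  have : 0 <= (1 - w) * k /\ 0 <= (1 - w) * (1 - k).
    by split; apply: mulr_ge0; slra.
  case=> h5 h6; case: (ltP 0 w) => [wp|wn]; last first.
    have -> : w = 0 by slra.
    by apply/andP; split; slra.
  have : 0 < w * (1 - k + ep * t) by apply: mulr_gt0 => //; slra.
  have : 0 < w * (k - ep * t) by apply: mulr_gt0 => //; slra.
  by move=> *; apply/andP; split; slra.
right; split; first split=> /frame_tri[s1 [s2 [w [s10 s20 wp h /inj[_ h2]]]]].
- have w1 : w <= 1 by slra.
  by have := w0 w wp w1; slra.
- have w1 : w <= 1 by slra.
  by have := w0 w wp w1; slra.
exists (F 0 0); split.
- exists (1 / 2); first by slra.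
  by rewrite frame_lerp; congr (F _ _); field.
- exists k => //.
  by rewrite frame_lerp; congr (F _ _); ring.
Qed.

Lemma turn_pair g h r : g \in E -> h \in E -> g != h -> seg g r -> seg h r ->
  tri a b c r -> seg (a, b) r.
Proof.
move=> gE hE' n gr hr tr.
suff [->|->] : r = a \/ r = b by [apply: (seg_src (a, b)) | apply: (seg_tgt (a, b))].
case: (eqVneq g f) => [gf|gf]; last exact: hm gf _ tr gr.
by apply: (hm hE' _ tr hr); rewrite -gf eq_sym.
Qed.

(** The crossing at [p] of the edge along the first axis and of [f], along the
    second one, is replaced by a crossing at [q] in which the former edge has the
    direction of [cb]: since [t] is arbitrary, it may have any direction that
    crosses [f] in the same sense. *)
Lemma turn :
  [/\ is_diagram (bent D a b c E), virtual_move D (bent D a b c E),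
      forall P, covers D (p :: P) -> covers (bent D a b c E) (q :: P) &
      [/\ mark (bent D a b c E) (c, b) f = mark D (a, b) f,
          inner (c, b) q, inner f q & (c, b) != f]].
Proof.
have hg := turn_good.
have [h1 h2] := bend hD hE hg turn_far turn_pair.
have qs : seg (c, b) q /\ seg f q.
  have [/andP[? ?] /andP[? ?]] := (k1, k0).
  split; [exists (1 / 2); first by slra|exists (k - ep * t / 2); first by slra].
  - by rewrite frame_lerp; congr (F _ _); field.
  - by rewrite frame_lerp; congr (F _ _); field.
have [_ q1 q2] := at_q qs.1 qs.2.
split=> //; last first.
  split=> //; first by rewrite /= old_edge2 (old_edge_id hg).
  by apply/eqP => h; have := good_uniq hg; rewrite /= h fE andbF.
move=> P hP.
have new e g r : e \in [:: (a, c); (c, b)] -> g \in E -> inner e r -> inner g r -> r = q.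
  move=> eN gE ir jr.
  case: (eqVneq g f) => [gf|gf]; rewrite ?gf in jr.
    move: eN ir; rewrite !inE => /orP[]/eqP-> /inner_seg ir.
      by case: (f_ac ir (inner_seg jr)).
    by case: (at_q ir (inner_seg jr)).
  move: eN ir; rewrite !inE => /orP[]/eqP-> ir.
  - case: (hm gE gf (tri1 b (inner_seg ir)) (inner_seg jr)) => ra; last first.
      by case: b_ac; rewrite -ra; apply: inner_seg.
    by case: (inner_ends (e := (a, c)) nac ir).
  - case: (hm gE gf (tri2 a (inner_seg ir)) (inner_seg jr)) => ra.
      by case: a_cb; rewrite -ra; apply: inner_seg.
    by case: (inner_ends (e := (c, b)) ncb ir).
have case2 g : g \in edges (bent D a b c E) -> g \in [:: (a, c); (c, b)] \/ g \in E.
  by rewrite /= !inE orbA => /orP; case; [left|right].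
move=> e g r /case2[eN|eE] /case2[gN|gE] n ir jr m dn; rewrite inE.
- case: (new_disjoint hg); exists r; move: n ir jr.
  by move: eN gN; rewrite !inE => /orP[]/eqP-> /orP[]/eqP->; rewrite ?eqxx.
- by rewrite (new e g r) // eqxx.
- by rewrite (new g e r) // eqxx.
- move: m; rewrite /= !(old_edge_id hg) // => m.
  have [e1 e2] : e \in edges D /\ g \in edges D by rewrite !(perm_mem hE) !ED.
  have := hP e g r e1 e2 n ir jr m dn; rewrite inE => /orP[/eqP rp|->]; last by rewrite orbT.
  case: (generic_double gD abD (ED eE) (ED gE) (abE eE) (abE gE) n _ (inner_seg ir) (inner_seg jr)).
  rewrite rp; exists (1 / 2); first by slra.
  by rewrite frame_lerp; apply: point_eq => /=; field.
Qed.

End Triangle.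

End Turn.

Section Descent.
Variable R : realType.
Implicit Types (e f g : edge R) (p q a b c : point R) (E : seq (edge R)).
Implicit Types (D : diagram R) (P : seq (point R)).

Lemma edge_eq e f : e.1 = f.1 -> e.2 = f.2 -> e = f.
Proof. by case: e f => [? ?] [? ?] /= -> ->. Qed.

Lemma iso_move D D' : virtual_move D D' -> virtually_isotopic D D'.
Proof. exact: rst_step. Qed.

Lemma iso_trans D1 D2 D3 :
  virtually_isotopic D1 D2 -> virtually_isotopic D2 D3 -> virtually_isotopic D1 D3.
Proof. exact: rst_trans. Qed.

Lemma min_pos (l : seq R) : (forall x, x \in l -> 0 < x) ->
  exists2 m, 0 < m & forall x, x \in l -> m < x.
Proof.
elim: l => [|x l IH] h; first by exists 1.
have [m m0 hm] := IH (fun y yl => h y (mem_behead (s := x :: l) yl)).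
have x0 := h x (mem_head _ _).
exists (Num.min m (x / 2)); first by rewrite lt_min m0 divr_gt0.
move=> y; rewrite inE gt_min => /orP[/eqP->|/hm->//].
by apply/orP; right; lra.
Qed.

Section NearCrossing.
Variables (p u v : point R).
Hypothesis duv : u.1 * v.2 - u.2 * v.1 != 0.
Notation F := (frame p u v).

Lemma tri_axis_right (ep t w : R) r : 0 < ep -> ep <= w ->
  tri (F (- ep) 0) (F ep 0) (F (- ep) (- (ep * t))) r ->
  seg (F ep 0, F w 0) r -> r = F ep 0.
Proof.
move=> ep0 epw /frame_tri[z1 [z2 [z3 [z10 z20 z30 zs ->]]]].
move=> /frame_seg[z /andP[w0 w1] /(frame_inj duv)[h _]].
have h1 : 0 <= z * (w - ep) by apply: mulr_ge0; lra.
have h2 : 0 <= ep * (z1 + z3) by apply: mulr_ge0; lra.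
have h4 : 0 <= ep * (1 - z2) by apply: mulr_ge0; lra.
have : ep * (1 - z2) = 0 by lra.
move/eqP; rewrite mulf_eq0 (gt_eqF ep0) => /eqP z2e.
have -> : z1 = 0 by lra.
have -> : z3 = 0 by lra.
have -> : z2 = 1 by lra.
by congr (F _ _); ring.
Qed.

Lemma tri_axis_left (ep t w : R) r : 0 < ep -> t != 0 -> ep <= w ->
  tri (F (- ep) 0) (F ep 0) (F (- ep) (- (ep * t))) r ->
  seg (F (- w) 0, F (- ep) 0) r -> r = F (- ep) 0.
Proof.
move=> ep0 t0 epw /frame_tri[z1 [z2 [z3 [z10 z20 z30 zs ->]]]].
move=> /frame_seg[z /andP[w0 w1] /(frame_inj duv)[h h']].
have h1 : 0 <= (1 - z) * (w - ep) by apply: mulr_ge0; lra.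
have h2 : 0 <= ep * z2 by apply: mulr_ge0; lra.
have h3 : ep * z1 + ep * z2 + ep * z3 = ep by rewrite -!mulrDr zs mulr1.
have : ep * z2 = 0 by lra.
move/eqP; rewrite mulf_eq0 (gt_eqF ep0) => /eqP z2e.
have : z3 * (ep * t) = 0 by lra.
move/eqP; rewrite !mulf_eq0 (negPf t0) (gt_eqF ep0) !orbF => /eqP z3e.
have -> : z1 = 1 by lra.
by rewrite z2e z3e; congr (F _ _); ring.
Qed.

Lemma tri_box (ep t : R) r : 0 < ep ->
  tri (F (- ep) 0) (F ep 0) (F (- ep) (- (ep * t))) r ->
  exists x y : R, [/\ r = F x y, `|x| <= ep & `|y| <= ep * `|t|].
Proof.
move=> ep0 /frame_tri[z1 [z2 [z3 [z10 z20 z30 zs ->]]]].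
eexists; eexists; split; first by [].
- have : 0 <= ep * z1 /\ 0 <= ep * z2 /\ 0 <= ep * z3 by rewrite !mulr_ge0 // ltW.
  have : ep * z1 + ep * z2 + ep * z3 = ep by rewrite -!mulrDr zs mulr1.
  by move=> ? [? [? ?]]; rewrite ler_norml; apply/andP; split; lra.
- rewrite !mulr0 !add0r mulrN normrN !normrM (gtr0_norm ep0) (ger0_norm z30).
  by rewrite -[leRHS]mul1r ler_wpM2r ?mulr_ge0 ?(ltW ep0) //; lra.
Qed.

End NearCrossing.

(** A non-horizontal edge [f] can be crossed by a downward edge in either
    sense, so that the crossing edge [e] can be turned downwards near [f]. *)
Lemma half_turn D P p e f : is_diagram D -> covers D (p :: P) ->
  e \in edges D -> f \in edges D -> e != f -> inner e p -> inner f p ->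
  mark D e f <> Virtual -> ~~ down e -> f.2.2 != f.1.2 ->
  exists D' e' p', [/\ is_diagram D', virtually_isotopic D D' & covers D' (p' :: P)] /\
    [/\ e' \in edges D', f \in edges D', e' != f, inner e' p' & inner f p'] /\
    mark D' e' f <> Virtual /\ down e'.
Proof.
move=> hD hP eD fD nef ip jp m de hf.
have gD := diagram_good hD.
pose E0 := rem e (edges D).
have hE0 : perm_eq (edges D) (e :: E0) by apply: perm_to_rem.
have E0D g : g \in E0 -> g \in edges D by move=> h; rewrite (perm_mem hE0) inE h orbT.
have fE0 : f \in E0 by have := fD; rewrite (perm_mem hE0) inE eq_sym (negPf nef).
have eE0 : e \notin E0 by have := good_uniq (good_perm hE0 gD) => /andP[].
pose u : point R := (e.2.1 - e.1.1, e.2.2 - e.1.2).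
pose v : point R := (f.2.1 - f.1.1, f.2.2 - f.1.2).
have duv : u.1 * v.2 - u.2 * v.1 != 0.
  by apply: (good_cross gD eD fD nef); exists p.
have v0 : v.2 != 0 by rewrite /v /= subr_eq0.
have u0 : 0 <= u.2 by move: de; rewrite /down -leNgt /u /= subr_ge0.
(* This makes [2 u + t v], the direction of [cb], point downwards. *)
pose t : R := (- 2 * u.2 - 1) / v.2.
have tv : t * v.2 = - 2 * u.2 - 1 by rewrite /t mulfVK.
have t0 : t != 0 by apply/eqP => h; move: tv; rewrite h mul0r; lra.
have [s [s0 s1 es]] : exists s : R, [/\ 0 < s, s < 1 &
    e = (frame p u v (- s) 0, frame p u v (1 - s) 0)].
  case: (ip) => s /andP[s0 s1] ps; exists s; split=> //.
  by apply: edge_eq; rewrite ps; apply: point_eq => /=; ring.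
have [k [k0 k1 fk]] : exists k : R, [/\ 0 < k, k < 1 &
    f = (frame p u v 0 (- k), frame p u v 0 (1 - k))].
  case: (jp) => k /andP[k0 k1] pk; exists k; split=> //.
  by apply: edge_eq; rewrite pk; apply: point_eq => /=; ring.
have [d d0 hd] := clearance p u v (fun g gE => good_neq gD (E0D g gE)).
have t'0 : 0 < `|t| by rewrite normr_gt0.
(* The triangle must stay between the ends of [e] and [f] and meet no other edge. *)
have [ep ep0 hep] : exists2 ep : R, 0 < ep & forall x, x \in
    [:: s; 1 - s; d; d / `|t|; k / `|t|; (1 - k) / `|t|] -> ep < x.
  apply: min_pos => x; rewrite !inE => /or4P[/eqP->|/eqP->|/eqP->|] //; first by lra.
  by case/or3P => /eqP->; rewrite divr_gt0 // subr_gt0.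
have ep_s : ep < s by apply: hep; rewrite !inE eqxx.
have ep_s' : ep < 1 - s by apply: hep; rewrite !inE eqxx !orbT.
have ep_d : ep < d by apply: hep; rewrite !inE eqxx !orbT.
have ep_d' : ep * `|t| < d by rewrite -ltr_pdivlMr // hep // !inE eqxx !orbT.
have ep_k : ep * `|t| < k by rewrite -ltr_pdivlMr // hep // !inE eqxx !orbT.
have ep_k' : ep * `|t| < 1 - k by rewrite -ltr_pdivlMr // hep // !inE eqxx !orbT.
have nt : `|ep * t| = ep * `|t| by rewrite normrM gtr0_norm.
have k1' : - k < - (ep * t) < 1 - k.
  move: (ler_norm (ep * t)) (ler_norm (- (ep * t))); rewrite normrN nt => *.
  by apply/andP; split; lra.
pose F := frame p u v.
have Finj : forall x y x' y', F x y = F x' y' -> x = x' /\ y = y' by apply: frame_inj.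
pose a := F (- ep) 0; pose b := F ep 0; pose c := F (- ep) (- (ep * t)).
(* No third edge passes through the crossing [p]. *)
have near g (x y : R) : g \in E0 -> g != f -> `|x| <= ep -> `|y| <= ep * `|t| -> ~ seg g (F x y).
  move=> gE gf hx hy; apply: hd => //.
  - move=> gp; apply: (generic_double gD eD fD (E0D _ gE) nef _ _ (inner_seg ip) (inner_seg jp) gp).
      by apply: contraNneq eE0 => ->.
    by rewrite eq_sym.
  - by apply: le_trans hx (ltW ep_d).
  - by apply: le_trans hy (ltW ep_d').
have far (x : R) : x != 0 -> ~ seg f (F x 0).
  rewrite fk => x0 /frame_seg[z hz /Finj[h _]]; move/eqP: x0; apply; lra.
have off (x : R) g : x != 0 -> `|x| <= ep -> g \in E0 -> ~ seg g (F x 0).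
  move=> x0 hx gE; case: (eqVneq g f) => [->|gf]; first exact: far.
  by apply: near => //; rewrite normr0 mulr_ge0 // ltW.
have nep : `|ep| = ep by rewrite gtr0_norm.
have ep_neq : ep != 0 by rewrite gt_eqF.
have hE0' : perm_eq (edges D) ((e.1, e.2) :: E0) by case: (e) hE0.
have ia : inner (e.1, e.2) a.
  rewrite es; exists (s - ep); first by apply/andP; split; lra.
  by rewrite frame_lerp /a; congr (frame _ _ _ _ _); ring.
have aE g : g \in E0 -> ~ seg g a.
  by apply: off; rewrite ?oppr_eq0 // normrN nep.
have [hD1 m1 c1] := subdivide hD hE0' ia aE.
have g1 := subdivide_good hD hE0' ia aE.
set D1 := bent _ _ _ _ _ in hD1 m1 c1.
pose E1 := (e.1, a) :: E0.
have hE1 : perm_eq (edges D1) ((a, e.2) :: E1) by apply: (permEl (perm_catCA [:: _] [:: _] _)).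
have ib : inner (a, e.2) b.
  rewrite es /=; exists (2 * ep / (1 - s + ep)).
    by apply/andP; split; [apply: divr_gt0|rewrite ltr_pdivrMr]; lra.
  have h : 1 - s + ep != 0 by apply/eqP; lra.
  by rewrite frame_lerp /b; congr (frame _ _ _ _ _); field.
have bE g : g \in E1 -> ~ seg g b.
  rewrite inE => /orP[/eqP->|]; last by apply: off; rewrite ?nep.
  rewrite es /= => /frame_seg[z /andP[z0 z1] /Finj[h _]].
  have : 0 <= (1 - z) * (s - ep) by apply: mulr_ge0; lra.
  by lra.
have [hD2 m2 c2] := subdivide hD1 hE1 ib bE.
have g2 := subdivide_good hD1 hE1 ib bE.
set D2 := bent _ _ _ _ _ in hD2 m2 c2.
pose E := (b, e.2) :: E1.
have hE2 : perm_eq (edges D2) ((a, b) :: E) by [].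
have fE : (F 0 (- k), F 0 (1 - k)) \in E by rewrite -fk !inE fE0 !orbT.
have hm g : g \in E -> g != (F 0 (- k), F 0 (1 - k)) -> misses a b c g.
  move=> gE; rewrite -fk => gf r tr gr.
  move: gE gr; rewrite !inE => /or3P[/eqP->|/eqP->|gE0] gr.
  - by right; move: gr; rewrite es; apply: (tri_axis_right duv ep0 (ltW ep_s') tr).
  - by left; move: gr; rewrite es; apply: (tri_axis_left duv ep0 t0 (ltW ep_s) tr).
  - have [x [y [re hx hy]]] := tri_box ep0 tr.
    by case: (near g x y gE0 gf hx hy); rewrite /F -re.
have k0' : 0 < k < 1 by rewrite k0.
have [hD3 m3 c3 [m4 i3 j3 n3]] := turn duv ep0 t0 k1' k0' hD2 hE2 fE hm.
exists (bent D2 a b c E), (c, b), (F 0 (- (ep * t) / 2)).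
rewrite -/F -fk in m4 j3 n3 *.
split; last split; last split.
- split=> //; last by apply: c3; apply: c2; apply: c1.
  by apply: iso_trans (iso_move m1) (iso_trans (iso_move m2) (iso_move m3)).
- split=> //; first by rewrite !inE eqxx orbT.
  by rewrite !inE fE0 !orbT.
- rewrite m4 /= old_edge1 (old_edge_id g2) ?inE ?fE0 ?orbT //.
  by rewrite /= old_edge2 (old_edge_id g1) //; case: (e) m.
- rewrite /down /b /c /=; rewrite -subr_gt0.
  have -> : p.2 + - ep * u.2 + - (ep * t) * v.2 - (p.2 + ep * u.2 + 0 * v.2) =
     - 2 * ep * u.2 - ep * (t * v.2) by ring.
  by rewrite tv; lra.
Qed.

(** No third edge passes through the crossing of [e] and [f] at [p]. *)
Lemma settled D P p e f : is_diagram D -> covers D (p :: P) ->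
  e \in edges D -> f \in edges D -> e != f -> inner e p -> inner f p ->
  down e -> down f -> covers D P.
Proof.
move=> hD hP eD fD n ip jp de df g h q gD hD' ngh iq jq m dg.
have := hP g h q gD hD' ngh iq jq m dg; rewrite inE => /orP[/eqP qp|//].
rewrite {}qp in iq jq.
have [ge|ge] := eqVneq g e; first by rewrite ge de in dg.
have [gf|gf] := eqVneq g f; first by rewrite gf df in dg.
rewrite eq_sym in ge; rewrite eq_sym in gf.
by case: (generic_double (diagram_good hD) eD fD gD n ge gf (inner_seg ip)
  (inner_seg jp) (inner_seg iq)).
Qed.

Lemma mark_flip D e f : is_diagram D -> e \in edges D -> f \in edges D -> e != f ->
  cross e f -> mark D e f <> Virtual -> mark D f e <> Virtual.
Proof.
case=> _ g _ eD fD n x m; rewrite (generic_mark g eD fD n x).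
by case: (mark D e f) m.
Qed.

(** Once [e] goes downwards it is not horizontal, so that [f] can be turned
    across it. *)
Lemma full_turn D P p e f : is_diagram D -> covers D (p :: P) ->
  e \in edges D -> f \in edges D -> e != f -> inner e p -> inner f p ->
  mark D e f <> Virtual -> ~~ down e -> f.2.2 != f.1.2 ->
  exists D', [/\ is_diagram D', virtually_isotopic D D' & covers D' P].
Proof.
move=> hD hP eD fD n ip jp m de hf.
have [D1 [e1 [p1 [[h1 s1 c1] [[e1D fD1 n1 i1 j1] [m1 d1]]]]]] :=
  half_turn hD hP eD fD n ip jp m de hf.
case: (boolP (down f)) => df.
  by exists D1; split=> //; apply: (settled h1 c1 e1D fD1).
have x1 : cross e1 f by exists p1.
have hd : e1.2.2 != e1.1.2 by rewrite lt_eqF.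
rewrite eq_sym in n1.
have [D2 [f2 [p2 [[h2 s2 c2] [[f2D eD2 n2 i2 j2] [m2 d2]]]]]] :=
  half_turn h1 c1 fD1 e1D n1 j1 i1
    (mark_flip h1 e1D fD1 (etrans (congr1 negb (eq_sym _ _)) n1) x1 m1) df hd.
exists D2; split=> //; first exact: iso_trans s1 s2.
by apply: (settled h2 c2 f2D eD2).
Qed.

(** One of two transversal edges is not horizontal; the other one is turned
    first. *)
Lemma uncover D P p : is_diagram D -> covers D (p :: P) ->
  exists D', [/\ is_diagram D', virtually_isotopic D D' & covers D' P].
Proof.
move=> hD hP; case: (pselect (covers D P)) => hPP.
  by exists D; split=> //; apply: rst_refl.
have [e [f [[eD fD n ip jp] [m de]]]] : exists e f, [/\ e \in edges D, f \in edges D,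
    e != f, inner e p & inner f p] /\ mark D e f <> Virtual /\ ~~ down e.
  apply: contrapT => no; apply: hPP => e f q eD fD n iq jq m de.
  have := hP e f q eD fD n iq jq m de; rewrite inE => /orP[/eqP qp|//].
  by case: no; exists e, f; rewrite -qp.
have [hf|hf] := boolP (f.2.2 != f.1.2); first exact: (full_turn hD hP eD fD n).
have x : cross e f by exists p.
have d := good_cross (diagram_good hD) eD fD n x.
move/negPn/eqP in hf.
have he : e.2.2 != e.1.2.
  apply: contraNneq d => he; rewrite /edet he hf !subrr; apply/eqP; ring.
have df : ~~ down f by rewrite /down hf ltxx.
have m' := mark_flip hD eD fD n x m.
by rewrite eq_sym in n; apply: (full_turn hD hP fD eD n jp ip m' df he).
Qed.

(** Each crossing is turned once, since turning one creates no other classical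
    crossing. *)
Lemma descending L : is_diagram L ->
  exists D, [/\ is_diagram D, virtually_isotopic L D & covers D [::]].
Proof.
move=> hL.
have [W [_ hW]] := double_points (diagram_good hL).
have : covers L W.
  by move=> e f p eL fL n /inner_seg ip /inner_seg jp _ _; apply: (hW e f).
elim: W L hL {hW} => [|p W IH] L hL hP; first by exists L; split=> //; apply: rst_refl.
have [D1 [h1 s1 c1]] := uncover hL hP.
have [D2 [h2 s2 c2]] := IH D1 h1 c1.
by exists D2; split=> //; apply: iso_trans s1 s2.
Qed.

End Descent.

(** * Separating the downward edges *)

Section Split.
Variable R : realType.
Implicit Types (e f g : edge R) (p q a b c : point R) (E K N : seq (edge R)).
Implicit Types (D : diagram R) (P : seq (point R)).

(** The edges through the end [b] meet [ab] only there, and the others stay at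
    a distance from [b]. *)
Lemma short_end a b E : good ((a, b) :: E) -> exists2 c, inner (a, b) c &
  forall g p, g \in E -> seg (c, b) p -> seg g p -> p = b.
Proof.
move=> gD; have abD : (a, b) \in (a, b) :: E := mem_head _ _.
have ED g : g \in E -> g \in (a, b) :: E by rewrite inE => ->; rewrite orbT.
have abE g : g \in E -> (a, b) != g.
  by move=> gE; apply/eqP => h; have := good_uniq gD; rewrite /= h gE.
pose u : point R := (a.1 - b.1, a.2 - b.2).
have [d d0 hd] := clearance b u u (fun g gE => good_neq gD (ED g gE)).
have [x x0 hx] : exists2 x : R, 0 < x & forall y, y \in [:: d; 1] -> x < y.
  by apply: min_pos => y; rewrite !inE => /orP[]/eqP->.
have xd : x < d by apply: hx; rewrite !inE eqxx.
have x1 : x < 1 by apply: hx; rewrite !inE eqxx orbT.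
pose c : point R := lerp (a, b) (1 - x).
have ic : inner (a, b) c by exists (1 - x) => //; apply/andP; split; lra.
exists c => // g p gE cp gp.
have hp := half2 ic cp.
have [gb|gb] := pselect (seg g b); last first.
  case: cp gp => z /andP[z0 z1] -> gp; exfalso.
  apply: (hd g ((1 - z) * x) 0 gE gb); rewrite ?normr0 ?ltW //.
    rewrite ger0_norm; last by apply: mulr_ge0; lra.
    have : 0 <= z * x by apply: mulr_ge0; lra.
    by lra.
  by move: gp; congr (seg g _); apply: point_eq => /=; ring.
have hab := good_neq gD abD; have [ca cb] := inner_ends hab ic.
case: (generic_meet gD abD (ED g gE) (abE g gE) hp gp) => [[<- //]|[_ pa]|[ip _ dd]].
  case: ca; apply/esym; apply: (halves hab ic); first exact: (seg_src (a, c)).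
  by rewrite pa.
by have := meet_unique dd hp gp (seg_tgt (a, b)) gb.
Qed.

Definition virtual_edge D e := forall f, f \in edges D -> e != f -> cross e f ->
  mark D e f = Virtual.

Lemma covers0_virtual D e : covers D [::] -> e \in edges D -> ~~ down e ->
  virtual_edge D e.
Proof.
move=> hD eD de f fD n [p [ip jp]]; apply: contrapT => m.
by have := hD e f p eD fD n ip jp m de.
Qed.

(** Cutting the tail off each downward edge separates the downward edges, which
    carry all the classical crossings, from each other. *)
Lemma separate T D K N : is_diagram D -> covers D [::] ->
  perm_eq (edges D) (K ++ N ++ T) ->
  (forall e, e \in K -> down e) -> (forall e, e \in N -> virtual_edge D e) ->
  (forall e f, e \in K -> f \in edges D -> f.1 = e.2 -> f \in N) ->
  exists D' K' N', [/\ is_diagram D', virtually_isotopic D D' &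
    perm_eq (edges D') (K' ++ N')] /\
    [/\ forall e, e \in K' -> down e, forall e, e \in N' -> virtual_edge D' e &
    forall e f, e \in K' -> f \in edges D' -> f.1 = e.2 -> f \in N'].
Proof.
elim: T D K N => [|[a b] T IH] D K N hD hP hE hK hN hKN.
  exists D, K, N; rewrite cats0 in hE.
  by split=> //; split=> //; apply: rst_refl.
have [dab|dab] := boolP (down (a, b)); last first.
  apply: (IH D K ((a, b) :: N)) => //.
  - apply: (perm_trans hE); rewrite perm_cat2l.
    by apply: (permEl (perm_catCA N [:: (a, b)] T)).
  - move=> e; rewrite inE => /orP[/eqP->|/hN//].
    by apply: covers0_virtual => //; rewrite (perm_mem hE) !mem_cat inE eqxx !orbT.
  - by move=> e f eK fD h; rewrite inE (hKN e f eK fD h) orbT.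
pose E := K ++ N ++ T.
have hE' : perm_eq (edges D) ((a, b) :: E).
  apply: (perm_trans hE); rewrite /E !catA -[_ :: _]/([:: (a, b)] ++ _).
  by apply: (permEl (perm_catCA _ [:: (a, b)] _)).
have gD := good_perm hE' (diagram_good hD).
have [c ic cE] := short_end gD.
have hab := good_neq gD (mem_head _ _).
have [ca cb] := inner_ends hab ic.
have cE' g : g \in E -> ~ seg g c.
  by move=> gE gc; case: cb; apply: (cE g c gE (seg_src (c, b)) gc).
have [h1 m1 c1] := subdivide hD hE' ic cE'.
have hg := subdivide_good hD hE' ic cE'.
have hf := subdivide_far hD hE' ic.
set D' := bent D a b c E in h1 m1 c1.
have ED g : g \in E -> g \in edges D by move=> gE; rewrite (perm_mem hE') inE gE orbT.
have KE g : g \in K -> g \in E by rewrite mem_cat => ->.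
have NE g : g \in N -> g \in E by rewrite !mem_cat => ->; rewrite orbT.
have [D2 [K2 [N2 [[h2 i2 p2] r2]]]] : exists D2 K' N', [/\ is_diagram D2,
    virtually_isotopic D' D2 & perm_eq (edges D2) (K' ++ N')] /\
    [/\ forall e, e \in K' -> down e, forall e, e \in N' -> virtual_edge D2 e &
    forall e f, e \in K' -> f \in edges D2 -> f.1 = e.2 -> f \in N'].
  apply: (IH D' ((a, c) :: K) ((c, b) :: N)) => //; first exact: c1.
  - rewrite /= perm_cons /E -[_ :: _ ++ _ ++ T]/([:: (c, b)] ++ K ++ N ++ T).
    by apply: (permEl (perm_catCA [:: (c, b)] K _)).
  - by move=> e; rewrite inE => /orP[/eqP->|/hK//]; rewrite (half_down ic) // inE eqxx.
  - move=> e; rewrite inE => /orP[/eqP->|eN] f fD n x.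
      move: fD n x; rewrite /D' /= !inE => /or3P[/eqP->|/eqP->|fE].
      + by move=> _ /cross_sym/(new_disjoint hg).
      + by rewrite eqxx.
      + move=> _ [p [ip jp]]; have pb := cE f p fE (inner_seg ip) (inner_seg jp).
        have m2 : (c, b) \in [:: (a, c), (c, b) & E] by rewrite !inE eqxx orbT.
        by case: (inner_ends (good_neq hg m2) ip).
    have eD : e \in edges D' by rewrite /= !inE (NE e eN) !orbT.
    have [n' x'] := old_edge_cross hD hE' hg hf eD fD n x.
    rewrite /= (old_edge_id hg (NE e eN)) in n' x' *.
    by apply: hN => //; apply: (old_edge_mem hE' hg).
  - have m1' : (a, c) \in [:: (a, c), (c, b) & E] by rewrite !inE eqxx.
    have m2' : (c, b) \in [:: (a, c), (c, b) & E] by rewrite !inE eqxx orbT.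
    move=> e f; rewrite inE => /orP[/eqP->|eK] fD h.
      by rewrite (good_src hg fD m2' h) mem_head.
    move: fD h; rewrite /= !inE => /or3P[/eqP->|/eqP->|fE] h.
    + have abD : (a, b) \in edges D by rewrite (perm_mem hE') mem_head.
      have := hKN e (a, b) eK abD h => abN.
      by have := good_uniq gD; rewrite /= NE.
    + by case: (cE' e (KE e eK)); rewrite -[c]/((c, b).1) h; apply: seg_tgt.
    + by rewrite (hKN e f eK (ED f fE) h) orbT.
exists D2, K2, N2; split=> //; split=> //.
exact: iso_trans (iso_move m1) i2.
Qed.

End Split.

(** * Descending legs in general position *)

Section Route.
Variable R : realType.
Implicit Types (e f g : edge R) (p q a b c w : point R) (E : seq (edge R)).

Lemma seg_rev a b p : seg (a, b) p -> seg (b, a) p.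
Proof.
case=> t /andP[t0 t1] ->; exists (1 - t); first by apply/andP; split; lra.
by apply: point_eq => /=; ring.
Qed.

(** The abscissa at height [h] of the line through two points. *)
Definition abscissa a w (h : R) : R := a.1 + (h - a.2) / (w.2 - a.2) * (w.1 - a.1).

Lemma abscissaP a m w : a.2 != m.2 -> seg (a, m) w -> w <> a ->
  m.1 = abscissa a w m.2.
Proof.
move=> n [t _ ->] wa; rewrite /abscissa /=.
have t0 : t != 0.
  by apply/eqP => h; apply: wa; rewrite h; apply: point_eq => /=; ring.
have h : (1 - t) * a.2 + t * m.2 - a.2 = t * (m.2 - a.2) by ring.
rewrite h.
have n' : m.2 - a.2 != 0 by rewrite subr_eq0 eq_sym.
by field; rewrite n' t0.
Qed.

(** The abscissa at height [h] of the line through [a] parallel to [f]. *)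
Definition abscissa_dir a f (h : R) : R :=
  a.1 + (h - a.2) / (f.2.2 - f.1.2) * (f.2.1 - f.1.1).

Lemma abscissa_dirP a m f : a.2 != m.2 -> f.1 != f.2 -> edet (a, m) f = 0 ->
  m.1 = abscissa_dir a f m.2.
Proof.
move=> n /eqP/edge_coord nf; rewrite /edet /abscissa_dir /= => h.
have n' : m.2 - a.2 != 0 by rewrite subr_eq0 eq_sym.
have f0 : f.2.2 - f.1.2 != 0.
  apply/eqP => f0; case: nf => // nf; apply: nf; apply: (mulfI n').
  by rewrite mulr0; move: h; rewrite f0; lra.
apply: (mulIf f0); rewrite mulrDl mulrAC mulfVK //; lra.
Qed.

Lemma seg_between e p : seg e p -> Num.min e.1.2 e.2.2 <= p.2 <= Num.max e.1.2 e.2.2.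
Proof.
case=> t /andP[t0 t1] -> /=.
have h1 : 0 <= t * `|e.2.2 - e.1.2| by rewrite mulr_ge0.
have h2 : 0 <= (1 - t) * `|e.2.2 - e.1.2| by rewrite mulr_ge0 // subr_ge0.
rewrite ge_min le_max; case: (lerP e.1.2 e.2.2) => h.
  by rewrite ger0_norm ?subr_ge0 // in h1 h2; apply/andP; split; apply/orP; [left|right]; lra.
rewrite ltr0_norm ?subr_lt0 // in h1 h2; apply/andP; split; apply/orP; [right|left]; lra.
Qed.

(** A leg avoids the double points and the vertices and is transversal to the
    edges as soon as its free end avoids finitely many points. *)
Lemma leg (W : seq (point R)) E a h : (forall f, f \in E -> f.1 != f.2) -> a.2 != h ->
  exists B : seq R, forall x, x \notin B ->
    (forall w, w \in W -> w <> a -> ~ seg (a, (x, h)) w) /\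
    (forall f, f \in E -> edet (a, (x, h)) f != 0).
Proof.
move=> pE ah.
exists ([seq abscissa a w h | w <- W] ++ [seq abscissa_dir a f h | f <- E]) => x.
rewrite mem_cat negb_or => /andP[n1 n2]; split.
- move=> w wW wa s; move/negP: n1; apply.
  by rewrite -[x]/((x, h).1) (abscissaP (m := (x, h)) ah s wa); apply: map_f.
- move=> f fE; apply/eqP => d; move/negP: n2; apply.
  by rewrite -[x]/((x, h).1) (abscissa_dirP (m := (x, h)) ah (pE f fE) d); apply: map_f.
Qed.

Lemma edet_rev a b f : edet (b, a) f = - edet (a, b) f.
Proof. by rewrite /edet /=; ring. Qed.

(** A bend at height [h] leads from [P] down to [Q] in general position; the
    points [X] that it also avoids are ends of legs still to be drawn. *)
Lemma route (X : seq (point R)) E (P Q : point R) (h lo hi : R) : good E ->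
  Q.2 < h < P.2 -> lo < hi ->
  (forall f, f \in E -> seg f P -> f.2 = P) ->
  (forall f, f \in E -> seg f Q -> f.1 = Q) ->
  (forall f, f \in E -> f.1.2 = h -> f.2.2 <> h) ->
  exists x, [/\ lo < x < hi, good [:: (P, (x, h)), ((x, h), Q) & E] &
    forall w, w \in X -> w <> P -> w <> Q ->
      ~ seg (P, (x, h)) w /\ ~ seg ((x, h), Q) w].
Proof.
move=> gE /andP[hQ hP] lohi aP aQ noh.
have [W [hW1 hW2]] := double_points gE.
have pE f : f \in E -> f.1 != f.2 by apply: (good_neq gE).
have P_h : P.2 != h by rewrite gt_eqF.
have Q_h : Q.2 != h by rewrite lt_eqF.
have [B1 hB1] := leg (W ++ X) pE P_h.
have [B2 hB2] := leg (W ++ X) pE Q_h.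
have [x hx] := avoid (B1 ++ B2 ++ [seq abscissa f.1 f.2 h | f <- E]
   ++ [seq f.1.1 | f <- E]) lohi.
rewrite !mem_cat !negb_or => /and4P[/hB1[a1 d1] /hB2[a2 d2] n3 n4].
set m := (x, h) in a1 d1 a2 d2 *.
have mE f : f \in E -> ~ seg f m.
  move=> fE s; have [f1h|f1h] := eqVneq f.1.2 h.
    have [mf|/eqP mf] := eqVneq m f.1.
      by move/negP: n4; apply; rewrite -[x]/(m.1) mf; apply: map_f.
    case: s => t _ me; have me1 := congr1 fst me; have me2 := congr1 snd me.
    move: me1 me2 => /= me1 me2; have f2h := noh f fE f1h; rewrite f1h in me2.
    have : t * (f.2.2 - h) = 0 by lra.
    move/eqP; rewrite mulf_eq0 subr_eq0 (introF eqP f2h) orbF => /eqP t0.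
    by apply: mf; apply: point_eq; rewrite /= ?f1h // me1 t0; ring.
  have f2h : f.1.2 != f.2.2.
    apply: contraNneq f1h => ff; case: s => t _ me; have /= -> := congr1 snd me.
    by rewrite -ff; apply/eqP; ring.
  move/negP: n3; apply; apply/mapP; exists f => //.
  case: s => t _ me; have /= -> := congr1 fst me; have /= hh := congr1 snd me.
  rewrite /abscissa hh; have ff : f.2.2 - f.1.2 != 0 by rewrite subr_eq0 eq_sym.
  by field.
have hmQ r : seg (m, Q) r -> r.2 <= h.
  by move/seg_between; rewrite /= (max_l (ltW hQ)) => /andP[].
have hPm r : seg (P, m) r -> h <= r.2.
  by move/seg_between; rewrite /= (min_r (ltW hP)) => /andP[].
have mm r : seg (P, m) r -> seg (m, Q) r -> r = m.
  move=> s1 s2; have e2 : r.2 = h by apply/le_anti; rewrite hmQ // hPm.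
  apply: contrapT => rm.
  have r0 : r <> P by move=> rP; rewrite -rP e2 eqxx in P_h.
  case: (seg_inner s1 r0 rm) => t /andP[t0 t1] re; move: e2; rewrite re /=.
  have : 0 < (1 - t) * (P.2 - h) by apply: mulr_gt0; rewrite subr_gt0.
  by move=> *; lra.
have Pm : P != m by apply: contraNneq P_h => ->.
have mQ : m != Q by apply: contraNneq Q_h => <-.
exists x; split=> //; last first.
  move=> w wX wP wQ; split; first by apply: a1 => //; rewrite mem_cat wX orbT.
  by move=> s; apply: (a2 w _ wQ (seg_rev s)); rewrite mem_cat wX orbT.
have WW w : w \in W -> w \in W ++ X by rewrite mem_cat => ->.
apply: good_add => // [|f r]; last first.
- rewrite inE => /orP[/eqP->|fE] s1 s2; first by apply: Or32; rewrite /= (mm r s1 s2).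
  have [rP|/eqP rP] := eqVneq r P.
    by apply: Or31; rewrite rP in s2 *; split=> //; apply: aP.
  have rW : r \notin W by apply/negP => /WW/a1/(_ rP); apply.
  apply: Or33; split=> //.
  + by apply: seg_inner => // rm; apply: (mE f fE); rewrite -[m]/((P, m).2) -rm.
  + have [w1 w2] := hW1 f fE.
    by apply: seg_inner => // rf; move: rW; rewrite rf ?w1 ?w2.
  + exact: d1.
  + move=> g; rewrite inE => /orP[/eqP-> _ s3|gE' n s3].
      by apply: (mE f fE); rewrite -(mm r s1 s3).
    by move/negP: rW; apply; apply: (hW2 g f) => //.
apply: good_add => // f r fE s1 s2.
have [rQ|/eqP rQ] := eqVneq r Q.
  by apply: Or32; rewrite rQ in s2 *; split=> //; apply: aQ.
have rW : r \notin W by apply/negP => /WW/a2/(_ rQ); apply; apply: seg_rev.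
apply: Or33; split=> //.
+ by apply: seg_inner => // rm; apply: (mE f fE); rewrite -[m]/((m, Q).1) -rm.
+ have [w1 w2] := hW1 f fE.
  by apply: seg_inner => // rf; move: rW; rewrite rf ?w1 ?w2.
+ by rewrite edet_rev oppr_eq0; apply: d2.
+ move=> g gE' n s3.
  by move/negP: rW; apply; apply: (hW2 g f) => //.
Qed.

End Route.

(** * Closing arcs *)

Section Arcs.
Variable R : realType.
Implicit Types (e f g : edge R) (p q a b c w : point R) (E : seq (edge R)).

Lemma between (t y y' : R) : 0 <= t <= 1 -> y <= y' ->
  y <= (1 - t) * y + t * y' <= y'.
Proof.
move=> /andP[t0 t1] h.
have h1 : 0 <= t * (y' - y) by apply: mulr_ge0; lra.
have h2 : 0 <= (1 - t) * (y' - y) by apply: mulr_ge0; lra.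
by apply/andP; split; lra.
Qed.

Lemma seg_vert (x y y' : R) p : seg ((x, y), (x, y')) p ->
  p.1 = x /\ (y <= p.2 <= y' \/ y' <= p.2 <= y).
Proof.
case=> t ht -> /=; split; first by ring.
case: (leP y y') => [h|/ltW h]; [left|right]; first exact: between.
by have := between ht h; case/andP: ht => *; apply/andP; split; lra.
Qed.

Lemma seg_horiz (x x' y : R) p : seg ((x, y), (x', y)) p ->
  p.2 = y /\ (x <= p.1 <= x' \/ x' <= p.1 <= x).
Proof.
case=> t ht -> /=; split; first by ring.
case: (leP x x') => [h|/ltW h]; [left|right]; first exact: between.
by have := between ht h; case/andP: ht => *; apply/andP; split; lra.
Qed.

Definition outer_arc (x B T r h : R) : seq (edge R) :=
  chain (x, B) [:: (x, B - h); (r + h, B - h); (r + h, T + h); (x, T + h); (x, T)].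

Lemma arc_points x B T r h f p : 0 < h -> x < r -> B < T -> f \in outer_arc x B T r h ->
  seg f p ->
  [\/ p.1 = x /\ (B - h <= p.2 <= B \/ T <= p.2 <= T + h),
      x <= p.1 <= r + h /\ (p.2 = B - h \/ p.2 = T + h) |
      p.1 = r + h /\ B - h <= p.2 <= T + h].
Proof.
move=> h0 xr BT; rewrite /outer_arc /chain /= !inE => /orP[/eqP->|/or4P[]/eqP->].
- by move=> /seg_vert[p1 p2]; apply: Or31; split=> //; left; case: p2 => ?; lra.
- by move=> /seg_horiz[p2 p1]; apply: Or32; split; [case: p1 => ?; lra|left].
- by move=> /seg_vert[p1 p2]; apply: Or33; split=> //; case: p2 => ?; lra.
- by move=> /seg_horiz[p2 p1]; apply: Or32; split; [case: p1 => ?; lra|right].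
- by move=> /seg_vert[p1 p2]; apply: Or31; split=> //; right; case: p2 => ?; lra.
Qed.

Lemma arcs_disjoint x x' B T r h h' e f p : x < x' -> x' < r -> 0 < h' -> h' < h ->
  B < T -> e \in outer_arc x B T r h -> f \in outer_arc x' B T r h' -> seg e p -> ~ seg f p.
Proof.
move=> xx xr h0 hh BT eA fA se sf.
have h0' : 0 < h by lra.
have xr' : x < r by lra.
have := arc_points h0 xr BT fA sf; have := arc_points h0' xr' BT eA se.
case=> [[p1 [p2|p2]]|[p1 [p2|p2]]|[p1 p2]]; case=> [[q1 [q2|q2]]|[q1 [q2|q2]]|[q1 q2]];
  lra.
Qed.

Lemma good_extend a b E : good E -> a != b ->
  (forall f p, f \in E -> seg f p -> seg (a, b) p -> p = b /\ f.1 = b) ->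
  good ((a, b) :: E).
Proof. by move=> gE ab h; apply: good_add => // f p fE s1 s2; apply: Or32; apply: h. Qed.

Lemma good_nil : good (R := R) [::].
Proof. by split. Qed.

Lemma arc_good x B T r h : 0 < h -> x < r -> B < T -> good (outer_arc x B T r h).
Proof.
move=> h0 xr BT.
have nex (p q : point R) : p.1 <> q.1 \/ p.2 <> q.2 -> p != q.
  by move=> n; apply/eqP => pq; rewrite pq in n; case: n.
have g5 : good [:: ((x, T + h), (x, T))].
  by apply: good_extend; [exact: good_nil|apply: nex; right => /=; lra|].
have g4 : good [:: ((r + h, T + h), (x, T + h)); ((x, T + h), (x, T))].
  apply: good_extend => //; first by apply: nex; left => /=; lra.
  move=> f p; rewrite !inE => /eqP-> /seg_vert[h1 _] /seg_horiz[h2 _].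
  by split=> //; apply: point_eq.
have g3 : good [:: ((r + h, B - h), (r + h, T + h));
    ((r + h, T + h), (x, T + h)); ((x, T + h), (x, T))].
  apply: good_extend => //; first by apply: nex; right => /=; lra.
  move=> f p; rewrite !inE => /orP[]/eqP->.
    move=> /seg_horiz[h1 _] /seg_vert[h2 _].
    by split=> //; apply: point_eq.
  by move=> /seg_vert[h1 _] /seg_vert[h2 _]; exfalso; lra.
have g2 : good [:: ((x, B - h), (r + h, B - h)); ((r + h, B - h), (r + h, T + h));
    ((r + h, T + h), (x, T + h)); ((x, T + h), (x, T))].
  apply: good_extend => //; first by apply: nex; left => /=; lra.
  move=> f p; rewrite !inE => /or3P[]/eqP->.
  - move=> /seg_vert[h1 _] /seg_horiz[h2 _].
    by split=> //; apply: point_eq.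
  - by move=> /seg_horiz[h1 _] /seg_horiz[h2 _]; exfalso; lra.
  - by move=> /seg_vert[h1 [h3|h3]] /seg_horiz[h2 _]; exfalso; lra.
apply: good_extend => //; first by apply: nex; right => /=; lra.
move=> f p; rewrite !inE => /or4P[]/eqP->.
- move=> /seg_horiz[h1 _] /seg_vert[h2 _].
  by split=> //; apply: point_eq.
- by move=> /seg_vert[h1 _] /seg_vert[h2 _]; exfalso; lra.
- by move=> /seg_horiz[h1 _] /seg_vert[_ [h2|h2]]; exfalso; lra.
- by move=> /seg_vert[_ [h1|h1]] /seg_vert[_ [h2|h2]]; exfalso; lra.
Qed.

Lemma good_cat E E' : good E -> good E' ->
  (forall e f p, e \in E -> f \in E' -> seg e p -> ~ seg f p) -> good (E ++ E').
Proof.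
move=> g1 g2 dis; split.
- rewrite map_cat cat_uniq (generic_src g1) (generic_src g2) andbT.
  apply/hasPn => _ /mapP[f fE ->]; apply/mapP => -[e eE h].
  by apply: (dis e f e.1) => //; [apply: seg_src|rewrite -h; apply: seg_src].
- rewrite map_cat cat_uniq (generic_tgt g1) (generic_tgt g2) andbT.
  apply/hasPn => _ /mapP[f fE ->]; apply/mapP => -[e eE h].
  by apply: (dis e f e.2) => //; [apply: seg_tgt|rewrite -h; apply: seg_tgt].
- by move=> e; rewrite mem_cat => /orP[/(good_neq g1)|/(good_neq g2)].
- move=> e f p; rewrite !mem_cat => /orP[eE|eE] /orP[fE|fE] n s1 s2.
  + exact: (generic_meet g1).
  + by case: (dis e f p).
  + by case: (dis f e p).
  + exact: (generic_meet g2).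
- move=> e f g p; rewrite !mem_cat => /orP[eE|eE] /orP[fE|fE] /orP[gE|gE] n1 n2 n3 s1 s2 s3.
  + exact: (generic_double g1 eE fE gE n1 n2 n3 s1 s2 s3).
  + exact: (dis f g p).
  + exact: (dis e f p).
  + exact: (dis e f p).
  + exact: (dis f e p).
  + exact: (dis f e p).
  + exact: (dis g e p).
  + exact: (generic_double g2 eE fE gE n1 n2 n3 s1 s2 s3).
- by [].
Qed.

(** The arcs are nested: the further left an arc starts, the wider it is. *)
Lemma arcs_good n (B T r : R) : n%:R <= r -> B < T ->
  good (flatten [seq outer_arc i%:R B T r (n - i)%:R | i <- iota 0 n]).
Proof.
move=> nr BT.
have rng i : (i < n)%N -> (0 : R) < (n - i)%:R /\ (i%:R : R) < r.
  move=> i_n; rewrite ltr0n subn_gt0; split=> //.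
  by apply: lt_le_trans nr; rewrite ltr_nat.
have dis i j e f p : (i < j < n)%N -> e \in outer_arc i%:R B T r (n - i)%:R ->
    f \in outer_arc j%:R B T r (n - j)%:R -> seg e p -> ~ seg f p.
  move=> /andP[ij jn]; have [h0 jr] := rng j jn.
  by apply: arcs_disjoint => //; rewrite ltr_nat // ltn_sub2l // (ltn_trans ij).
have : {subset iota 0 n <= gtn n} by move=> i; rewrite mem_iota.
elim: (iota 0 n) (iota_uniq 0 n) => [|i s IH] /=; first by move=> *; apply: good_nil.
move=> /andP[is_ us] sub; have [h0 ir] := rng i (sub i (mem_head _ _)).
apply: (good_cat (E := outer_arc i%:R B T r (n - i)%:R)); first exact: arc_good.
  by apply: IH => // j js; apply: sub; rewrite inE js orbT.
move=> e f p eA /flatten_mapP[j js fA] s1 s2.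
have jn : (j < n)%N by apply: sub; rewrite inE js orbT.
case: (ltngtP i j) => ij.
- by apply: (dis i j e f p) => //; rewrite ij.
- by apply: (dis j i f e p) => //; rewrite ij; apply: sub; rewrite mem_head.
- by rewrite ij js in is_.
Qed.

Lemma seg_box e p : seg e p -> forall M N : R,
  M < e.1.2 < N -> M < e.2.2 < N -> M < p.2 < N.
Proof.
move=> /seg_between/andP[h1 h2] M N /andP[a1 a2] /andP[b1 b2].
apply/andP; split; first by apply: lt_le_trans h1; rewrite lt_min a1.
by apply: le_lt_trans h2 _; rewrite gt_max a2.
Qed.

Lemma seg_left e p : seg e p -> forall r : R, e.1.1 <= r -> e.2.1 <= r -> p.1 <= r.
Proof.
case=> t /andP[t0 t1] -> r h1 h2 /=.
have : 0 <= t * (r - e.2.1) by rewrite mulr_ge0 ?subr_ge0.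
have : 0 <= (1 - t) * (r - e.1.1) by rewrite mulr_ge0 ?subr_ge0.
by lra.
Qed.

Lemma arc_outside x B T r h e f p : 0 < h -> x < r -> B < T ->
  B < e.1.2 < T -> B < e.2.2 < T -> e.1.1 <= r -> e.2.1 <= r ->
  f \in outer_arc x B T r h -> seg f p -> ~ seg e p.
Proof.
move=> h0 xr BT a1 a2 a3 a4 fA sf se.
have := seg_box se a1 a2; have := seg_left se a3 a4.
case: (arc_points h0 xr BT fA sf) => [[p1 [p2|p2]]|[p1 [p2|p2]]|[p1 p2]]; lra.
Qed.

End Arcs.

(** * Rerouting the edges without classical crossings *)

Section Permutations.
Variable T : eqType.
Implicit Types (x : T) (a b c d e f g : seq T).

Lemma perm_pull x a b c d : perm_eq (a ++ b ++ (x :: c) ++ d) (x :: a ++ b ++ c ++ d).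
Proof. by rewrite -(cat1s x c) -(cat1s x (a ++ _)); apply/seq.permP => Q; rewrite !count_cat; lia. Qed.

Lemma perm_push a b c d e f :
  perm_eq (f ++ e ++ a ++ b ++ c ++ d) (a ++ b ++ c ++ d ++ e ++ f).
Proof. by apply/seq.permP => Q; rewrite !count_cat; lia. Qed.

Lemma perm_defer a b c d : perm_eq ((a ++ b ++ c) ++ d) (((a ++ b) ++ d) ++ c).
Proof. by apply/seq.permP => Q; rewrite !count_cat; lia. Qed.

Lemma perm_gather a b c d e f g :
  perm_eq ((a ++ b) ++ c ++ d ++ e ++ f ++ g) ((f ++ b ++ g) ++ a ++ c ++ d ++ e).
Proof. by apply/seq.permP => Q; rewrite !count_cat; lia. Qed.

End Permutations.

Section Reroute.
Variable R : realType.
Implicit Types (e f g : edge R) (p q a b c w : point R) (E : seq (edge R)).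
Implicit Types (D : diagram R).

Lemma reroute D D' p q (s : seq (point R)) E : is_diagram D ->
  perm_eq (edges D) ((p, q) :: E) -> perm_eq (edges D') (chain p s ++ E) ->
  last p s = q -> good (edges D') -> same_marks E D D' ->
  (forall e f, e \in edges D' -> f \in edges D' -> e != f -> cross e f ->
     mark D' f e = flip (mark D' e f)) ->
  virtual_along [:: (p, q)] D -> virtual_along (chain p s) D' ->
  is_diagram D' /\ virtual_move D D'.
Proof.
move=> hD hE hE' sq gD' sm fl v v'.
have pq : p != q by apply: (good_neq (good_perm hE (diagram_good hD)) (mem_head _ _)).
have hD' : is_diagram D'.
  split.
  - apply/eqP => e0; move: hE'; rewrite e0 perm_sym => /perm_nilP.
    by case: s sq {v'} => //= pq'; rewrite pq' eqxx in pq.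
  - exact: good_generic.
  - case: hD => _ _ /seq.permP h; apply/seq.permP => Q.
    have /seq.permP/(_ Q) h1 := perm_map (fun e : edge R => e.1) hE.
    have /seq.permP/(_ Q) h2 := perm_map (fun e : edge R => e.2) hE.
    have /seq.permP/(_ Q) h3 := perm_map (fun e : edge R => e.1) hE'.
    have /seq.permP/(_ Q) h4 := perm_map (fun e : edge R => e.2) hE'.
    have /seq.permP/(_ Q) h5 := chain_src p s.
    have := h Q; rewrite h1 h2 h3 h4 !map_cat !count_cat chain_tgt.
    by move: h5; rewrite sq /=; lia.
split=> //; apply: Move_detour; exists p, q, [:: q], s, E.
by split; [split|split].
Qed.

Lemma bounded E : exists2 M : R, 0 < M & forall e, e \in E ->
  [/\ -M < e.1.1 < M, -M < e.1.2 < M, -M < e.2.1 < M & -M < e.2.2 < M].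
Proof.
elim: E => [|e E [M M0 hM]]; first by exists 1.
pose S := `|e.1.1| + `|e.1.2| + `|e.2.1| + `|e.2.2|.
have S0 : 0 <= S by rewrite !addr_ge0.
exists (M + S); first by rewrite ltr_pwDl.
move=> f; rewrite inE => /orP[/eqP->|/hM[h1 h2 h3 h4]]; last first.
  by split; apply/andP; split; lra.
have := normr_ge0 e.1.1; have := normr_ge0 e.1.2; have := normr_ge0 e.2.1;
have := normr_ge0 e.2.2 => *.
split; rewrite -ltr_norml /S; lra.
Qed.

End Reroute.

Section Routing.
Variables (R : realType) (D0 : diagram R) (K N : seq (edge R)) (M : R).
Hypothesis hD0 : is_diagram D0.
Hypothesis hE0 : perm_eq (edges D0) (K ++ N).
Hypothesis hN : forall e, e \in N -> virtual_edge D0 e.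
Hypothesis M0 : 0 < M.
Hypothesis hM : forall e, e \in edges D0 ->
  [/\ -M < e.1.1 < M, -M < e.1.2 < M, -M < e.2.1 < M & -M < e.2.2 < M].
Implicit Types (e f g : edge R) (p q a b c w : point R) (E : seq (edge R)).
Implicit Types (D : diagram R) (mu nu : nat -> R).

(** Crossings outside [K] are made virtual once and for all, so that a single
    marking serves at every stage. *)
Definition sparse_mark e f :=
  if (e \in K) && (f \in K) then mark D0 e f else Virtual.

Notation n := (size N).
Definition bot : R := - M - 1.
Definition top : R := M + 1.
Definition right : R := M + n%:R + 1.
Definition origin (i : nat) : point R := (nth ((0, 0), (0, 0)) N i).1.
Definition target (i : nat) : point R := (nth ((0, 0), (0, 0)) N i).2.

Definition leg_down (x : R) (i : nat) : seq (edge R) :=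
  [:: (origin i, (x, - M)); ((x, - M), (i%:R, bot))].
Definition leg_up (y : R) (i : nat) : seq (edge R) :=
  [:: ((i%:R, top), (y, M)); ((y, M), target i)].
Definition nth_arc (i : nat) := outer_arc i%:R bot top right (n - i)%:R.
Definition arcs (s : seq nat) := flatten [seq nth_arc i | i <- s].
Definition legs mu nu k :=
  flatten [seq leg_down (mu i) i ++ leg_up (nu i) i | i <- iota 0 k].
Definition rest mu nu k := K ++ drop k N ++ legs mu nu k.
Definition stage mu nu k := Diagram (arcs (iota 0 k) ++ rest mu nu k) sparse_mark.

(** The first two conditions keep horizontal edges away from the heights of the
    bends; the others leave the ends of the arcs numbered from [k] on free for
    the routes still to come. *)
Definition fits k e := [/\ e.1.2 = - M -> e.2.2 <> - M, e.1.2 = M -> e.2.2 <> M,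
  forall j : nat, (k <= j)%N -> e.2 <> (j%:R, bot) &
  forall j : nat, (k <= j)%N -> e.1 <> (j%:R, top)].

Lemma sparse_flip e f : e != f -> cross e f ->
  sparse_mark f e = flip (sparse_mark e f).
Proof.
move=> n x; rewrite /sparse_mark andbC; case: ifP => // /andP[eK fK].
have KD g : g \in K -> g \in edges D0 by move=> h; rewrite (perm_mem hE0) mem_cat h.
by case: hD0 => _ g0 _; apply: (generic_mark g0) => //; apply: KD.
Qed.

Lemma sparse_virtual e f : e \notin K -> sparse_mark e f = Virtual.
Proof. by rewrite /sparse_mark => /negPf->. Qed.

Lemma nat_lt_right i : (i < n)%N -> (i%:R : R) < right.
Proof.
move=> h; have : (i%:R : R) <= n%:R by rewrite ler_nat ltnW.
by move: M0 => M0' ?; rewrite /right; lra.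
Qed.

Lemma bot_top : bot < top.
Proof. by move: M0 => M0'; rewrite /bot /top; lra. Qed.

Lemma stage0 : is_diagram (stage (fun=> 0) (fun=> 0) 0) /\
  virtual_move D0 (stage (fun=> 0) (fun=> 0) 0).
Proof.
have E0 : edges (stage (fun=> 0) (fun=> 0) 0) = K ++ N.
  by rewrite /stage /= /rest /legs /arcs /= drop0 cats0.
have hD : is_diagram (stage (fun=> 0) (fun=> 0) 0).
  split.
  - case: hD0 => h _ _; rewrite E0; apply: contraNneq h => h.
    by move: hE0; rewrite h => /perm_nilP->.
  - apply: good_generic; last by move=> *; apply: sparse_flip.
    by rewrite E0; apply: (good_perm hE0 (diagram_good hD0)).
  - case: hD0 => _ _ /seq.permP h; apply/seq.permP => Q; have := h Q; rewrite E0.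
    have /seq.permP/(_ Q) -> := perm_map (fun e : edge R => e.1) hE0.
    by have /seq.permP/(_ Q) -> := perm_map (fun e : edge R => e.2) hE0.
split=> //; apply: Move_same => //; rewrite ?E0 // => e f.
rewrite !(perm_mem hE0) !mem_cat => eD fD n x; rewrite /= /sparse_mark.
have [eK|eK] := boolP (e \in K); last first.
  rewrite (negPf eK) /= in eD *; apply: hN => //.
  by rewrite (perm_mem hE0) mem_cat.
have [fK|fK] := boolP (f \in K) => //=; rewrite (negPf fK) /= in fD.
have eD' : e \in edges D0 by rewrite (perm_mem hE0) mem_cat eK.
have fD' : f \in edges D0 by rewrite (perm_mem hE0) mem_cat fD orbT.
case: hD0 => _ g0 _; have := hN fD eD'.
rewrite eq_sym (generic_mark g0 eD' fD' n x) => /(_ n (cross_sym x)).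
by case: (mark D0 e f).
Qed.

Lemma leg_fits k e : e \in K ++ N -> fits k e.
Proof.
move=> eD; rewrite -(perm_mem hE0) in eD; have [_ h1 _ h2] := hM eD.
move: M0 => M0'; split.
- by move=> h; lra.
- by move=> h; lra.
- by move=> j _ h; have /= := congr1 snd h; rewrite /bot; lra.
- by move=> j _ h; have /= := congr1 snd h; rewrite /top; lra.
Qed.

Lemma arc_fits k i e : (i < n)%N -> e \in nth_arc i -> fits k e.
Proof.
move=> i_n; have h0 : (0 : R) < (n - i)%:R by rewrite ltr0n subn_gt0.
move: M0 => M0'; rewrite /nth_arc /outer_arc /chain /= !inE /bot /top.
by move=> /orP[/eqP->|/or4P[]/eqP->]; split=> /= [h|h|j _ h|j _ h];
  try (have /= := congr1 snd h); rewrite /bot /top; lra.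
Qed.

(** All the arcs are required to be in general position with the current edges,
    although only the first [k] belong to the diagram: the arcs are fixed
    beforehand and the legs are fitted to them. *)
Definition invariant k mu nu :=
  [/\ good (arcs (iota 0 n) ++ rest mu nu k), is_diagram (stage mu nu k),
      virtually_isotopic D0 (stage mu nu k), forall e, e \in rest mu nu k -> fits k e &
      forall i, (i < k)%N -> 0 < mu i < 1 /\ 0 < nu i < 1].

Lemma invariant0 : invariant 0 (fun=> 0) (fun=> 0).
Proof.
have [h1 h2] := stage0.
have rE : rest (fun=> 0) (fun=> 0) 0 = K ++ N by rewrite /rest /legs /= drop0 cats0.
split=> //; last by move=> e; rewrite rE; apply: leg_fits.
  rewrite rE; apply: good_cat; last first.
  - move=> e f p /flatten_mapP[i]; rewrite mem_iota => /andP[_ i_n] eA.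
    rewrite -(perm_mem hE0) => /hM[a1 a2 a3 a4].
    have h0 : (0 : R) < (n - i)%:R by rewrite ltr0n subn_gt0.
    have nr : (0 : R) <= n%:R by rewrite ler0n.
    apply: (arc_outside h0 (nat_lt_right i_n) bot_top _ _ _ _ eA);
      by move: M0 => M0'; rewrite /bot /top /right; lra.
  - exact: (good_perm hE0 (diagram_good hD0)).
  - by apply: arcs_good; [move: M0 => M0'; rewrite /right; lra|apply: bot_top].
exact: iso_move.
Qed.

Lemma legs_step mu nu k x y :
  legs (fun i => if i == k then x else mu i) (fun i => if i == k then y else nu i) k.+1
  = legs mu nu k ++ leg_down x k ++ leg_up y k.
Proof.
rewrite /legs -addn1 iotaD map_cat flatten_cat /= !eqxx; congr (flatten _ ++ _).
apply/eq_in_map => i; rewrite mem_iota => /andP[_ ik].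
by rewrite (ltn_eqF ik).
Qed.

Lemma drop_step k : (k < n)%N -> drop k N = (origin k, target k) :: drop k.+1 N.
Proof.
move=> kn; rewrite (drop_nth ((0, 0), (0, 0)) kn) /origin /target.
by case: (nth _ N k).
Qed.

Lemma arc_mem k f : (k < n)%N -> f \in nth_arc k -> f \in arcs (iota 0 n).
Proof. by move=> kn fA; apply/flatten_mapP; exists k => //; rewrite mem_iota. Qed.

Lemma arcs_fits k f : f \in arcs (iota 0 n) -> fits k f.
Proof. by move/flatten_mapP=> [i]; rewrite mem_iota => /andP[_ ?]; apply: arc_fits. Qed.

Lemma later k j (y z : R) : (k < j)%N -> (k%:R, y) <> (j%:R, z) :> point R.
Proof.
by move=> kj h; have /eqP := congr1 fst h; rewrite eqr_nat => /eqP h'; rewrite h' ltnn in kj.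
Qed.

Lemma leg_down_fits k x e : - M < (origin k).2 < M -> e \in leg_down x k ->
  fits k.+1 e.
Proof.
move: M0 => M0' hp; rewrite !inE => /orP[]/eqP->; split=> /=.
- by lra.
- by lra.
- by move=> j _ h; have /= := congr1 snd h; rewrite /bot; lra.
- by move=> j _ h; move: hp; rewrite h /= /top; lra.
- by move=> _; rewrite /bot; lra.
- by lra.
- by move=> j; apply: later.
- by move=> j _ h; have /= := congr1 snd h; rewrite /top; lra.
Qed.

Lemma leg_up_fits k y e : - M < (target k).2 < M -> e \in leg_up y k ->
  fits k.+1 e.
Proof.
move: M0 => M0' hq; rewrite !inE => /orP[]/eqP->; split=> /=.
- by rewrite /top; lra.
- by rewrite /top; lra.
- by move=> j _ h; have /= := congr1 snd h; rewrite /bot; lra.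
- by move=> j; apply: later.
- by lra.
- by move=> _; lra.
- by move=> j _ h; move: hq; rewrite h /= /bot; lra.
- by move=> j _ h; have /= := congr1 snd h; rewrite /top; lra.
Qed.

(** The edge from [p] to [q] has virtual crossings only, so that replacing it by
    the descending leg from [p], the arc and the descending leg to [q] is a
    detour move. *)
Lemma invariant_step k mu nu : (k < n)%N -> invariant k mu nu ->
  exists mu' nu', invariant k.+1 mu' nu'.
Proof.
move=> kn [gG hD iD fit rng]; set p := origin k; set q := target k.
have M0' := M0.
have pqN : (p, q) \in N.
  by rewrite /p /q /origin /target -surjective_pairing mem_nth.
have pqD : (p, q) \in edges D0 by rewrite (perm_mem hE0) mem_cat pqN orbT.
have [/= p1 p2 q1 q2] := hM pqD.
pose E1 := arcs (iota 0 n) ++ K ++ drop k.+1 N ++ legs mu nu k.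
have pG : perm_eq (arcs (iota 0 n) ++ rest mu nu k) ((p, q) :: E1).
  by rewrite /rest (drop_step kn); apply: perm_pull.
have gpq := good_perm pG gG; have g1 := good_tail gpq.
have pq_E f : f \in E1 -> (p, q) != f.
  by move=> fE; apply/eqP => h; have := good_uniq gpq; rewrite /= h fE.
have E1_pq f : f \in E1 -> f \in (p, q) :: E1 by rewrite inE => ->; rewrite orbT.
have fit1 f : f \in E1 -> fits k f.
  rewrite mem_cat => /orP[/arcs_fits//|fE]; apply: fit; rewrite /rest (drop_step kn).
  by move: fE; rewrite !mem_cat inE => /or3P[] ->; rewrite ?orbT.
pose B : point R := (k%:R, bot); pose T : point R := (k%:R, top).
have arcE f : f \in nth_arc k -> f \in E1.
  by move=> fA; rewrite mem_cat (arc_mem kn fA).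
have aB f : f \in E1 -> seg f B -> f.1 = B.
  move=> fE s; pose c0 : edge R := (B, (k%:R, bot - (n - k)%:R)).
  have c0E : c0 \in E1 by apply: arcE; rewrite mem_head.
  have [->//|nf] := eqVneq f c0; rewrite eq_sym in nf.
  have := good_at_src g1 c0E fE nf s; have [_ _ h _] := fit1 f fE.
  by move/h: (leqnn k).
have aT f : f \in E1 -> seg f T -> f.2 = T.
  move=> fE s; pose c4 : edge R := ((k%:R, top + (n - k)%:R), T).
  have c4E : c4 \in E1 by apply: arcE; rewrite !inE eqxx !orbT.
  have [->//|nf] := eqVneq f c4; rewrite eq_sym in nf.
  have := good_at_tgt g1 c4E fE nf s; have [_ _ _ h] := fit1 f fE.
  by move/h: (leqnn k).
have ap f : f \in E1 -> seg f p -> f.2 = p.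
  by move=> fE; apply: (good_at_src gpq (mem_head _ _) (E1_pq f fE) (pq_E f fE)).
have aq f : f \in E1 -> seg f q -> f.1 = q.
  by move=> fE; apply: (good_at_tgt gpq (mem_head _ _) (E1_pq f fE) (pq_E f fE)).
have hlow : B.2 < - M < p.2 by rewrite /B /bot /=; apply/andP; split; lra.
have hhigh : q.2 < M < T.2 by rewrite /T /top /=; apply/andP; split; lra.
have [x [hx g2 xq]] := route [:: q] g1 hlow ltr01 ap aB
  (fun f fE => let: And4 h _ _ _ := fit1 f fE in h).
set m : point R := (x, - M) in g2 xq.
have qp : q <> p by move=> h; have /eqP := good_neq gpq (mem_head _ _); apply.
have qB : q <> B by move=> h; move: q2; rewrite h /B /bot /=; lra.
have [xq1 xq2] := xq q (mem_head _ _) qp qB.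
have aT' f : f \in [:: (p, m), (m, B) & E1] -> seg f T -> f.2 = T.
  rewrite !inE => /or3P[/eqP->|/eqP->|]; last exact: aT.
  - by move=> /seg_between/andP[_]; rewrite /= le_max /top => /orP[] ?; exfalso; lra.
  - by move=> /seg_between/andP[_]; rewrite /= le_max /top /bot => /orP[] ?; exfalso; lra.
have aq' f : f \in [:: (p, m), (m, B) & E1] -> seg f q -> f.1 = q.
  by rewrite !inE => /or3P[/eqP->|/eqP->|]; last exact: aq.
have high' f : f \in [:: (p, m), (m, B) & E1] -> f.1.2 = M -> f.2.2 <> M.
  rewrite !inE => /or3P[/eqP->|/eqP->|/fit1[]//] /=; lra.
have [y [hy g3 _]] := route [::] g2 hhigh ltr01 aT' aq' high'.
set m' : point R := (y, M) in g3.
pose mu' i := if i == k then x else mu i; pose nu' i := if i == k then y else nu i.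
exists mu', nu'.
have rE : rest mu' nu' k.+1 = K ++ drop k.+1 N ++ legs mu nu k ++ leg_down x k ++ leg_up y k.
  by rewrite /rest legs_step.
have g4 : good (arcs (iota 0 n) ++ rest mu' nu' k.+1).
  by rewrite rE; apply: good_perm g3; apply: (perm_push _ _ _ _ (leg_down x k) (leg_up y k)).
have eA : arcs (iota 0 n) = arcs (iota 0 k) ++ nth_arc k ++ arcs (iota k.+1 (n - k.+1)).
  have -> : iota 0 n = iota 0 k ++ k :: iota k.+1 (n - k.+1).
    by rewrite -{1}(subnKC kn) addSnnS iotaD.
  by rewrite /arcs map_cat flatten_cat.
have eA' : arcs (iota 0 k.+1) = arcs (iota 0 k) ++ nth_arc k.
  by rewrite /arcs -addn1 iotaD map_cat flatten_cat.
have eS : edges (stage mu' nu' k.+1) = (arcs (iota 0 k) ++ nth_arc k) ++ rest mu' nu' k.+1.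
  by rewrite -eA'.
have g5 : good (edges (stage mu' nu' k.+1)).
  apply: (@good_catl _ _ (arcs (iota k.+1 (n - k.+1)))).
  by apply: good_perm g4; rewrite eS eA; apply: perm_defer.
pose E := arcs (iota 0 k) ++ K ++ drop k.+1 N ++ legs mu nu k.
pose s := [:: m; B; (k%:R, bot - (n - k)%:R); (right + (n - k)%:R, bot - (n - k)%:R);
   (right + (n - k)%:R, top + (n - k)%:R); (k%:R, top + (n - k)%:R); T; m'; q].
have cE : chain p s = leg_down x k ++ nth_arc k ++ leg_up y k by [].
have pE : perm_eq (edges (stage mu nu k)) ((p, q) :: E).
  by rewrite /= /rest (drop_step kn); apply: perm_pull.
have pE' : perm_eq (edges (stage mu' nu' k.+1)) (chain p s ++ E).
  by rewrite cE eS rE; apply: perm_gather.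
have KE f : f \in K -> f \in E by rewrite !mem_cat => ->; rewrite orbT.
have [h1 h2] : is_diagram (stage mu' nu' k.+1) /\
    virtual_move (stage mu nu k) (stage mu' nu' k.+1).
  apply: (reroute hD pE pE') => //.
  - by move=> *; apply: sparse_flip.
  - move=> e f; rewrite inE => /eqP-> _ _ _; apply: sparse_virtual.
    apply/negP => /KE; have := good_uniq (good_perm pE (diagram_good hD)).
    by rewrite /= => /andP[/negPf->].
  - move=> e f eC _ _ _; apply: sparse_virtual; apply/negP => /KE eE.
    have := good_uniq (good_perm pE' g5); rewrite cat_uniq => /and3P[_ /hasPn/(_ e eE)].
    by rewrite /= eC.
split=> //.
- exact: iso_trans iD (iso_move h2).
- move=> e; rewrite rE; have old f : fits k f -> fits k.+1 f.
    by case=> a1 a2 a3 a4; split=> // j jk; [apply: a3|apply: a4]; apply: ltnW.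
  rewrite !mem_cat => /orP[eK|/orP[eN|/orP[eL|/orP[eA1|eA2]]]].
  + by apply/old/fit1; rewrite !mem_cat eK !orbT.
  + by apply/old/fit1; rewrite !mem_cat eN !orbT.
  + by apply/old/fit1; rewrite !mem_cat eL !orbT.
  + exact: leg_down_fits eA1.
  + exact: leg_up_fits eA2.
- move=> i; rewrite ltnS leq_eqVlt /mu' /nu' => /orP[/eqP->|ik].
    by rewrite eqxx.
  by rewrite (ltn_eqF ik); apply: rng.
Qed.

Lemma routed : exists mu nu, invariant n mu nu.
Proof.
suff : forall k, (k <= n)%N -> exists mu nu, invariant k mu nu by apply.
elim=> [|k IH] kn; first by exists (fun=> 0), (fun=> 0); apply: invariant0.
have [mu [nu h]] := IH (ltnW kn).
exact: invariant_step kn h.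
Qed.


(** * The braid *)

Hypothesis hK : forall e, e \in K -> down e.
Hypothesis hKN : forall e f, e \in K -> f \in edges D0 -> f.1 = e.2 -> f \in N.

Let gD : good (K ++ N).
Proof. exact: (good_perm hE0 (diagram_good hD0)). Qed.

Let KN e : e \in K -> e \notin N.
Proof.
move=> eK; apply/negP => eN; have := good_uniq gD.
by rewrite cat_uniq => /and3P[_ /hasPn/(_ e eN)]; rewrite /= eK.
Qed.

Let KD e : e \in K -> e \in K ++ N.
Proof. by rewrite mem_cat => ->. Qed.

Let ND e : e \in N -> e \in K ++ N.
Proof. by rewrite mem_cat orbC => ->. Qed.

Let edgeN (i : 'I_n) : (origin i, target i) \in N.
Proof. by rewrite /origin /target -surjective_pairing mem_nth. Qed.

Lemma successor e : e \in K ++ N -> exists2 f, f \in K ++ N & f.1 = e.2.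
Proof.
move=> eD; case: hD0 => _ _ /perm_mem h.
have : e.2 \in [seq e.2 | e <- edges D0] by apply: map_f; rewrite (perm_mem hE0).
by rewrite -h => /mapP[f fD ->]; exists f; rewrite // -(perm_mem hE0).
Qed.

Lemma predecessor e : e \in K ++ N -> exists2 f, f \in K ++ N & f.2 = e.1.
Proof.
move=> eD; case: hD0 => _ _ /perm_mem h.
have : e.1 \in [seq e.1 | e <- edges D0] by apply: map_f; rewrite (perm_mem hE0).
by rewrite h => /mapP[f fD ->]; exists f; rewrite // -(perm_mem hE0).
Qed.

Lemma n_gt0 : (0 < n)%N.
Proof.
have : edges D0 != [::] by case: hD0.
case E: (edges D0) => [//|e s] _.
have eD : e \in K ++ N by rewrite -(perm_mem hE0) E mem_head.
suff [f fN] : exists f, f \in N by move: fN; case: (N).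
move: (eD); rewrite mem_cat => /orP[eK|eN]; last by exists e.
have [f fD fe] := successor eD; exists f; apply: (hKN eK) => //.
by rewrite (perm_mem hE0).
Qed.

(** At most one edge starts at a given vertex; a list lets the strand absorb it
    whether it exists or not. *)
Definition kept i := [seq e <- K | e.1 == target i].

Lemma kept_cases i : kept i = [::] \/
  exists e, [/\ e \in K, e.1 = target i & kept i = [:: e]].
Proof.
case E: (kept i) => [|e s]; [by left|right; exists e].
have sub f : f \in e :: s -> f \in K /\ f.1 = target i.
  by rewrite -E mem_filter => /andP[/eqP].
have [eK e1] := sub e (mem_head _ _); split=> //.
have u : uniq (e :: s).
  by rewrite -E filter_uniq //; have := good_uniq gD; rewrite cat_uniq => /andP[].
case: s E u sub => // f s _ u sub.
have [fK f1] : f \in K /\ f.1 = target i by apply: sub; rewrite !inE eqxx orbT.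
have ef : e = f by apply: (good_src gD); rewrite ?KD // e1 f1.
by move: u; rewrite ef /= mem_head.
Qed.

Definition stop i := last (target i) [seq e.2 | e <- kept i].

Lemma stopP (i : 'I_n) : exists e, [/\ e \in K ++ N, e.2 = stop i &
  e = (origin i, target i) \/ e \in K /\ e.1 = target i].
Proof.
rewrite /stop; case: (kept_cases i) => [->|[e [eK e1 ->]]] /=.
  by exists (origin i, target i); split; [apply/ND/edgeN| |left].
by exists e; split; [apply: KD| |right].
Qed.

Lemma next_exists (i : 'I_n) : exists j : 'I_n, origin j == stop i.
Proof.
suff [f fN f1] : exists2 f, f \in N & f.1 = stop i.
  have jn : (index f N < n)%N by rewrite index_mem.
  by exists (Ordinal jn); rewrite /origin /= nth_index // f1.
rewrite /stop; case: (kept_cases i) => [k0|[e [eK e1 ->]]].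
  rewrite k0 /=; have [f fD f1] := successor (ND (edgeN i)); exists f => //.
  move: fD; rewrite mem_cat => /orP[fK|//].
  have : f \in kept i by rewrite mem_filter fK andbT f1.
  by rewrite k0.
have [f fD f1] := successor (KD eK); exists f => //.
by apply: (hKN eK) => //; rewrite (perm_mem hE0).
Qed.

Definition next (i : 'I_n) : 'I_n := xchoose (next_exists i).

Lemma nextP i : origin (next i) = stop i.
Proof. exact/eqP/(xchooseP (next_exists i)). Qed.

Let target_inj (i j : 'I_n) : target i = target j -> i = j.
Proof.
move=> h; apply/val_inj/eqP.
rewrite -(nth_uniq ((0, 0), (0, 0)) (ltn_ord i) (ltn_ord j)); last first.
  by have := good_uniq gD; rewrite cat_uniq => /and3P[].
by apply/eqP; apply: (good_tgt gD) => //; apply/ND/mem_nth/ltn_ord.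
Qed.

(** Two strands that stop at the same vertex reach it by the same edge. *)
Lemma next_inj : injective next.
Proof.
move=> i j h; have {h} : stop i = stop j by rewrite -!nextP h.
have [e [eD e2 ei]] := stopP i; have [f [fD f2 fj]] := stopP j.
rewrite -e2 -f2 => /(good_tgt gD eD fD) ef; subst f.
case: ei fj => [->|[eK e1]] [h|[eK' e1']]; apply: target_inj.
- by case: h.
- by move: (KN eK'); rewrite edgeN.
- by move: (KN eK); rewrite h edgeN.
- by rewrite -e1 -e1'.
Qed.

Section Braid.
Variables mu nu : nat -> R.
Hypothesis inv : invariant n mu nu.

Definition routed_braid : braid_diagram R n :=
  BraidDiagram (fun i => (nat_of_ord i)%:R) top bot right (perm next_inj)
    (fun i => [:: (nu i, M); target i] ++ [seq e.2 | e <- kept i]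
       ++ [:: (mu (next i), - M)]) sparse_mark.
Notation b := routed_braid.

Lemma strandE i :
  strand b i = leg_up (nu i) i ++ kept i ++ leg_down (mu (next i)) (next i).
Proof.
rewrite /strand /leg_down nextP /stop /= permE.
by case: (kept_cases i) => [->|[[u v] [_ /= e1 ->]]] //=; rewrite -e1.
Qed.

Lemma perm_flatten_cat (I : Type) (T : eqType) (F G : I -> seq T) (s : seq I) :
  perm_eq (flatten [seq F i ++ G i | i <- s])
    (flatten [seq F i | i <- s] ++ flatten [seq G i | i <- s]).
Proof.
elim: s => //= i s IH; rewrite -!catA perm_cat2l.
apply: perm_trans (permEl (perm_catCA _ _ _)).
by rewrite perm_cat2l.
Qed.

Lemma perm_fibres (I T : eqType) (h : T -> I) (ts : seq I) (s : seq T) :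
  uniq ts -> (forall x, x \in s -> h x \in ts) ->
  perm_eq (flatten [seq [seq x <- s | h x == t] | t <- ts]) s.
Proof.
elim: ts s => [|t ts IH] s /=.
  by move=> _; case: s => // x s /(_ x (mem_head _ _)).
move=> /andP[tn us] hs.
rewrite perm_sym -(permPl (permEl (perm_filterC (fun x => h x == t) s))) perm_cat2l perm_sym.
have -> : [seq [seq x <- s | h x == t'] | t' <- ts] =
    [seq [seq x <- [seq x <- s | h x != t] | h x == t'] | t' <- ts].
  apply/eq_in_map => t' t'ts; rewrite -filter_predI; apply: eq_filter => x /=.
  by case: eqP => // ->; rewrite andTb; symmetry; apply: contraNneq tn => <-.
apply: (IH [seq x <- s | h x != t]) => // x.
by rewrite mem_filter => /andP[xt /hs]; rewrite inE (negPf xt).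
Qed.

Lemma flatten_ord (T : eqType) (F : nat -> seq T) :
  flatten [seq F (nat_of_ord i) | i <- enum 'I_n] = flatten [seq F i | i <- iota 0 n].
Proof. by rewrite -val_enum_ord -map_comp. Qed.

Lemma kept_perm : perm_eq (flatten [seq kept (nat_of_ord i) | i <- enum 'I_n]) K.
Proof.
have -> : [seq kept (nat_of_ord i) | i <- enum 'I_n] =
    [seq [seq e <- K | e.1 == t] | t <- [seq target (nat_of_ord i) | i <- enum 'I_n]].
  exact: (map_comp (fun t => [seq e <- K | e.1 == t]) (fun i : 'I_n => target i)).
apply: perm_fibres; first by rewrite map_inj_uniq ?enum_uniq // => i j /target_inj.
move=> e eK; have [f fD f2] := predecessor (KD eK).
have fN : f \in N.
  move: fD; rewrite mem_cat => /orP[fK|//].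
  have eN : e \in N by apply: (hKN fK) => //; rewrite (perm_mem hE0) KD.
  by move: (KN eK); rewrite eN.
have jn : (index f N < n)%N by rewrite index_mem.
apply/mapP; exists (Ordinal jn); first by rewrite mem_enum.
by rewrite /target /= nth_index.
Qed.

Lemma braid_edgesE : perm_eq (braid_edges b) (K ++ legs mu nu n).
Proof.
rewrite /braid_edges (eq_map strandE).
apply: perm_trans (perm_flatten_cat _ _ _) _.
rewrite (flatten_ord (fun i => leg_up (nu i) i)).
have pA := perm_flatten_cat (fun i : 'I_n => kept i)
  (fun i : 'I_n => leg_down (mu (next i)) (next i)) (enum 'I_n).
have pN : perm_eq (flatten [seq leg_down (mu (next i)) (next i) | i <- enum 'I_n])
    (flatten [seq leg_down (mu i) i | i <- iota 0 n]).
  rewrite -(flatten_ord (fun i => leg_down (mu i) i)).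
  rewrite (map_comp (fun i : 'I_n => leg_down (mu i) i) next).
  apply/perm_flatten/perm_map/uniq_perm; last first.
  - move=> i; rewrite mem_enum; apply/mapP; exists (perm_inv (perm next_inj) i).
    by rewrite mem_enum.
    by rewrite -{1}(permKV (perm next_inj) i) permE.
  - exact: enum_uniq.
  - by rewrite (map_inj_uniq next_inj) enum_uniq.
have pL := perm_flatten_cat (fun i => leg_down (mu i) i) (fun i => leg_up (nu i) i) (iota 0 n).
have pK := kept_perm.
move: pA pN pL pK; rewrite /legs.
move=> /seq.permP pA /seq.permP pN /seq.permP pL /seq.permP pK.
apply/seq.permP => Q; move: (pA Q) (pN Q) (pL Q) (pK Q); rewrite !count_cat => -> -> -> ->.
by rewrite addnC addnA.
Qed.

Lemma closureE : perm_eq (edges (braid_closure b)) (edges (stage mu nu n)).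
Proof.
rewrite /= /rest drop_size /= perm_catC.
have -> : flatten [seq closing_arc b i | i <- enum 'I_n] = arcs (iota 0 n).
  exact: (flatten_ord nth_arc).
by rewrite perm_cat2l braid_edgesE.
Qed.

Lemma braid_edge_cases e : e \in braid_edges b -> [\/ e \in K,
  exists2 i, (i < n)%N & e \in leg_down (mu i) i |
  exists2 i, (i < n)%N & e \in leg_up (nu i) i].
Proof.
rewrite (perm_mem braid_edgesE) mem_cat => /orP[eK|/flatten_mapP[i]]; first exact: Or31.
rewrite mem_iota mem_cat => /andP[_ i_n] /orP[h|h]; [apply: Or32|apply: Or33]; by exists i.
Qed.

Lemma routed_is_braid : is_virtual_braid b.
Proof.
have [gG _ _ _ rng] := inv; have M0' := M0.
have nr : (0 : R) <= n%:R by rewrite ler0n.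
have KM e : e \in K -> _ := fun eK => hM (etrans (perm_mem hE0 e) (KD eK)).
have NM i (i_n : (i < n)%N) := hM (etrans (perm_mem hE0 _) (ND (edgeN (Ordinal i_n)))).
split.
- by move=> i j ij; rewrite /= ltr_nat.
- move=> e /braid_edge_cases[/hK//|[i i_n]|[i i_n]]; have /= [_ h1 _ h2] := NM i i_n;
    rewrite !inE => /orP[]/eqP->; rewrite /= /top /bot; lra.
- move=> e /braid_edge_cases[/KM[h1 _ h2 _]|[i i_n]|[i i_n]].
  + by rewrite /= /right; split; lra.
  + have /= [h1 _ h2 _] := NM i i_n; have [r1 r2] := rng i i_n.
    have := nat_lt_right i_n; rewrite /right => h3.
    by rewrite !inE => /orP[]/eqP-> /=; split; rewrite /right; lra.
  + have /= [h1 _ h2 _] := NM i i_n; have [r1 r2] := rng i i_n.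
    have := nat_lt_right i_n; rewrite /right => h3.
    by rewrite !inE => /orP[]/eqP-> /=; split; rewrite /right; lra.
- apply: good_generic; last by move=> *; apply: sparse_flip.
  apply: good_perm (good_catr gG); rewrite /rest drop_size /= perm_sym.
  exact: braid_edgesE.
Qed.

Lemma routed_closure : virtually_isotopic (braid_closure b) D0.
Proof.
have [_ hD iD _ _] := inv.
have p := closureE; have p' := p; rewrite perm_sym in p'.
apply: iso_trans (rst_sym _ _ _ _ iD); apply/rst_sym/iso_move.
apply: Move_same => //; split.
- case: hD => h _ _; apply: contraNneq h => h; rewrite h in p.
  by move: p; rewrite perm_sym => /perm_nilP->.
- apply: good_generic; last by move=> *; apply: sparse_flip.
  exact: good_perm p' (diagram_good hD).
- case: hD => _ _ /seq.permP h; apply/seq.permP => Q; have := h Q.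
  have /seq.permP/(_ Q) -> := perm_map (fun e : edge R => e.1) p'.
  by have /seq.permP/(_ Q) -> := perm_map (fun e : edge R => e.2) p'.
Qed.

End Braid.

End Routing.

Theorem theorem1 (R : realType) (L : diagram R) (hL : is_diagram L) :
  exists (n : nat) (b : braid_diagram R n),
    [/\ (1 <= n)%N, is_virtual_braid b &
        virtually_isotopic (braid_closure b) L].
Proof.
have [D [hD LD cD]] := descending hL.
have [|||D0 [K [N [[hD0 DD0 hE] [hK hN hKN]]]]] :=
  separate (T := edges D) (K := [::]) (N := [::]) hD cD (perm_refl _) => //.
have [M M0 hM] := bounded (edges D0).
have [mu [nu inv]] := routed hD0 hE hN M0 hM.
exists (size N), (routed_braid M hD0 hE hKN mu nu); split.
- exact: (n_gt0 hD0 hE hKN).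
- exact: routed_is_braid.
- apply: iso_trans (rst_sym _ _ _ _ (iso_trans LD DD0)).
  exact: routed_closure.
Qed.
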